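(* Let $1\le k\le n$ and $0\le\ell\le n$ be integers. The block diagonal matching field $\mathcal{B}_\ell$ produces a toric degeneration of the Grassmannian $\operatorname{Gr}(k,n)$: the Gröbner degeneration of the Plücker ideal $G_{k,n}$ with respect to the weight vector $\mathbf{w}_\ell$ is a flat family over $\mathbb{A}^1$ all of whose fibres over nonzero points are isomorphic to $\operatorname{Gr}(k,n)$ and whose fibre over $0$ is the (not necessarily normal) projective toric variety defined by the matching field ideal $J_{\mathcal{B}_\ell}$.
   Context: $\mathbb{K}$ is a field of characteristic $0$, $\mathbf{I}_{k,n}$ is the set of $k$-subsets of $[n]=\{1,\dots,n\}$, $X=(x_{i,j})$ is a $k\times n$ matrix of indeterminates. The Plücker ideal $G_{k,n}\subset\mathbb{K}[P_I: I\in\mathbf{I}_{k,n}]$ of $\operatorname{Gr}(k,n)$ is the kernel of the map sending $P_I$ to the maximal minor of $X$ with column set $I$. The block diagonal matching field $\mathcal{B}_\ell:\mathbf{I}_{k,n}\to S_k$ has $\mathcal{B}_\ell(I)=\mathrm{id}$ if $|I|=1$ or $|I\cap\{1,\dots,\ell\}|\ne1$, and $\mathcal{B}_\ell(I)=(1\,2)$ otherwise. The ideal $J_{\mathcal{B}_\ell}$ is the kernel of $\mathbb{K}[P_I]\to\mathbb{K}[x_{i,j}]$, $P_I\mapsto\operatorname{sgn}(\sigma)\,x_{\sigma(1),i_1}\cdots x_{\sigma(k),i_k}$, where $I=\{i_1<\dots<i_k\}$ and $\sigma=\mathcal{B}_\ell(I)$. Weight vector: $M_\ell$ is the $k\times n$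 matrix whose first row is $0$; whose second row has entry $\ell+1-j$ in column $j\le\ell$ and $n+\ell+1-j$ in column $j>\ell$; and whose $i$-th row, $i\ge3$, has entry $(i-1)(n+1-j)$ in column $j$. The weight $\mathbf{w}_\ell(P_I)$ is the minimum, over the terms of the minor of $X$ with column set $I$, of the sum of the entries of $M_\ell$ at the positions of the variables in the term. Gröbner degeneration: for $f=\sum_\alpha c_\alpha \mathbf{P}^\alpha\in G_{k,n}$ with $d=\min\{\alpha\cdot\mathbf{w}_\ell: c_\alpha\ne0\}$, put $\tilde f=\sum_\alpha c_\alpha t^{\alpha\cdot\mathbf{w}_\ell-d}\mathbf{P}^\alpha$. The family is the closed subscheme of $\mathbb{P}^{\binom nk-1}\times\mathbb{A}^1$ defined by all $\tilde f$, $f\in G_{k,n}$, with its projection to $\mathbb{A}^1$ (coordinate $t$). A toric degeneration of a projective variety is a flat family whose fibre over zero is a toric variety and all of whose other fibres are isomorphic to the original variety. *)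

(* Defs.v *)
From HB Require Import structures.
From mathcomp Require Import all_boot all_order all_algebra all_fingroup.
From mathcomp Require Export mpoly.
Set Implicit Arguments.
Unset Strict Implicit.
Unset Printing Implicit Defensive.
Import GRing.Theory.
Local Open Scope ring_scope.

(* ------------------------------------------------------------------------ *)
(* Flat modules                                                             *)
(* ------------------------------------------------------------------------ *)

Definition bilinear_map (R : comNzRingType) (U V W : lmodType R)
    (b : U -> V -> W) : Prop :=
  (forall v, linear (fun u => b u v)) /\ (forall u, linear (b u)).

(* \sum_(x <- s) x.1 (x) x.2 = 0 in the tensor product of U and V over R; by
   the universal property this means that every bilinear map kills s.       *)
Definition tensor_eq0 (R : comNzRingType) (U V : lmodType R)
    (s : seq (U * V)) : Prop :=
  forall (W : lmodType R) (b : U -> V -> W),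
    bilinear_map b -> \sum_(x <- s) b x.1 x.2 = 0.

(* M is flat: N (x) M -> N' (x) M is injective whenever N -> N' is.  Every
   element of a tensor product is the sum of a finite list of pure tensors. *)
Definition flat (R : comNzRingType) (M : lmodType R) : Prop :=
  forall (N N' : lmodType R) (f : {linear N -> N'}), injective f ->
  forall s : seq (N * M),
    tensor_eq0 [seq (f x.1, x.2) | x <- s] -> tensor_eq0 s.

(* ------------------------------------------------------------------------ *)
(* Closed subschemes of projective space, through their functors of points  *)
(* ------------------------------------------------------------------------ *)

(* A closed subscheme of P^(N-1) over Spec A is given by a set E of equations
   in {mpoly A[N]} which generates a homogeneous ideal (its members need not
   be homogeneous themselves).                                              *)
Definition equations (A : comNzRingType) (N : nat) := {mpoly A[N]} -> Prop.

Definition ideal_gen (R : comNzRingType) (E : R -> Prop) (p : R) : Prop :=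
  exists2 s : seq (R * R),
    (forall x, x \in s -> E x.2) & p = \sum_(x <- s) x.1 * x.2.

Definition submodule (R : comNzRingType) (V : lmodType R)
    (S : V -> Prop) : Prop :=
  S 0 /\ forall (a : R) u v, S u -> S v -> S (a *: u + v).

Definition same_set (T : Type) (S S' : T -> Prop) : Prop :=
  forall x, S x <-> S' x.

(* The R'-submodule of R'^N spanned by the image of S, that is, the image of
   S (x)_R R' in R'^N.                                                      *)
Definition pushforward (R R' : comNzRingType) N (h : {rmorphism R -> R'})
    (S : 'rV[R]_N -> Prop) (v : 'rV[R']_N) : Prop :=
  exists2 s : seq (R' * 'rV[R]_N),
    (forall x, x \in s -> S x.2) & v = \sum_(x <- s) x.1 *: map_mx h x.2.

Definition direct_summand (R : comNzRingType) N (S : 'rV[R]_N -> Prop) :=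
  submodule S /\
  exists S' : 'rV[R]_N -> Prop, [/\ submodule S',
    forall v, S v -> S' v -> v = 0 &
    forall v, exists u u', [/\ S u, S' u' & v = u + u']].

(* The elements of P^(N-1)(R): direct summands of R^N of rank one, i.e. which
   become lines over every field-valued point of Spec R.                    *)
Definition proj_space (R : comNzRingType) N (S : 'rV[R]_N -> Prop) : Prop :=
  direct_summand S /\
  forall (F : fieldType) (h : {rmorphism R -> F}),
    exists2 u : 'rV[F]_N, u != 0 &
      same_set (pushforward h S) (fun v => exists c : F, v = c *: u).

(* The R-valued points of the closed subscheme of P^(N-1) over A cut out by
   E, for an A-algebra R.                                                   *)
Definition points (A : comNzRingType) N (E : equations A N) (R : comAlgType A)
    (S : 'rV[R]_N -> Prop) : Prop :=
  proj_space S /\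
  forall f v, E f -> S v -> (map_mpoly (in_alg R) f).@[v 0] = 0.

Definition same_subscheme (A : comNzRingType) N (E E' : equations A N) : Prop :=
  forall (R : comAlgType A) (S : 'rV[R]_N -> Prop), points E S <-> points E' S.

(* Isomorphism of A-schemes: by Yoneda, a bijection between the R-valued
   points which is natural in the A-algebra R.                              *)
Definition isomorphic (A : comNzRingType) N N'
    (E : equations A N) (E' : equations A N') : Prop :=
  exists (phi : forall R : comAlgType A,
                  ('rV[R]_N -> Prop) -> ('rV[R]_N' -> Prop))
         (psi : forall R : comAlgType A,
                  ('rV[R]_N' -> Prop) -> ('rV[R]_N -> Prop)),
  [/\ forall (R : comAlgType A) S, points E S ->
        points E' (phi R S) /\ same_set (psi R (phi R S)) S,
      forall (R : comAlgType A) S', points E' S' ->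
        points E (psi R S') /\ same_set (phi R (psi R S')) S' &
      forall (R R' : comAlgType A) (h : {lrmorphism R -> R'}) S, points E S ->
        same_set (phi R' (pushforward h S)) (pushforward h (phi R S))].

Definition base_change (A B : comNzRingType) N (h : {rmorphism A -> B})
    (E : equations A N) : equations B N :=
  fun q => exists2 p, E p & q = map_mpoly h p.

(* The subscheme cut out by E is flat over Spec A: on each standard chart
   D_+('X_i) its coordinate ring is a flat A-module.  Since E generates a
   homogeneous ideal, this ring is A['X_0 .. 'X_(N-1)] / (E, 'X_i - 1);
   below, it is M and pi is the quotient map.                               *)
Definition flat_subscheme (A : comNzRingType) N (E : equations A N) : Prop :=
  forall i : 'I_N,
  exists (M : lmodType A) (pi : {linear {mpoly A[N]} -> M}),
    [/\ forall m, exists p, pi p = m,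
        forall p, pi p = 0 <-> ideal_gen (fun q => E q \/ q = 'X_i - 1) p &
        flat M].

(* ------------------------------------------------------------------------ *)
(* Toric varieties and toric degenerations                                  *)
(* ------------------------------------------------------------------------ *)

Definition toric_ideal (K : fieldType) N m (a : 'I_N -> 'X_{1..m}) :
    equations K N :=
  fun p => p \mPo [tuple 'X_[K, a i] | i < N] = 0.

(* A (not necessarily normal) projective toric variety: up to isomorphism, the
   closure of the image of a torus under a monomial map to projective space.
   The common degree e > 0 of the monomials makes the ideal homogeneous; any
   monomial map to projective space can be so written, by translating the
   exponents and adding one homogenizing variable.                          *)
Definition projective_toric (K : fieldType) N (E : equations K N) : Prop :=
  exists (N' m e : nat) (a : 'I_N' -> 'X_{1..m}),
    [/\ (0 < N')%N, (0 < e)%N, forall i, mdeg (a i) = e &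
        isomorphic E (toric_ideal (K := K) a)].

Definition eval_at (K : fieldType) (a : K) : {rmorphism {poly K} -> K} :=
  horner_eval a.

Definition fibre0 (K : fieldType) N (Y : equations {poly K} N) :
    equations K N :=
  base_change (eval_at 0) Y.

(* Here A^1 = Spec {poly K}, with coordinate t = 'X, and Y is a family of
   closed subschemes of P^(N-1) over A^1.  The points of A^1 are covered by
   the morphisms h from {poly K} to fields L, the nonzero ones by those with
   h t != 0; over such a point the original variety is base changed to L.   *)
Definition toric_degeneration (K : fieldType) N
    (E : equations K N) (Y : equations {poly K} N) : Prop :=
  [/\ flat_subscheme Y,
      projective_toric (fibre0 Y) &
      forall (L : fieldType) (h : {rmorphism {poly K} -> L}), h 'X != 0 ->
        isomorphic (base_change h Y) (base_change (h \o polyC) E)].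

(* ------------------------------------------------------------------------ *)
(* Groebner degenerations                                                   *)
(* ------------------------------------------------------------------------ *)

(* The minimum of a nonempty sequence. *)
Definition seq_min (s : seq nat) : nat := \big[minn/head 0%N s]_(x <- s) x.

Definition mweight N (w : 'I_N -> nat) (a : 'X_{1..N}) : nat :=
  (\sum_(i < N) a i * w i)%N.

Definition min_weight (K : fieldType) N (w : 'I_N -> nat) (f : {mpoly K[N]}) :=
  seq_min [seq mweight w a | a <- msupp f].

Definition homogenization (K : fieldType) N (w : 'I_N -> nat)
    (f : {mpoly K[N]}) : {mpoly {poly K}[N]} :=
  \sum_(a <- msupp f)
    (f@_a *: 'X^(mweight w a - min_weight w f)%N) *: 'X_[{poly K}, a].

Definition groebner_family (K : fieldType) N (w : 'I_N -> nat)
    (E : equations K N) : equations {poly K} N :=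
  fun q => exists2 f, E f & q = homogenization w f.

(* ------------------------------------------------------------------------ *)
(* Pluecker ideals and block diagonal matching fields                       *)
(* ------------------------------------------------------------------------ *)

Section Grassmannian.
Variables (K : fieldType) (k n : nat).

Definition ksubsets : {set {set 'I_n}} := [set I : {set 'I_n} | #|I| == k].

(* The Pluecker variables are numbered by i : 'I_nplucker; number i stands for
   the k-subset plucker_set i.                                              *)
Definition nplucker : nat := #|ksubsets|.

Definition plucker_set (i : 'I_nplucker) : {set 'I_n} := enum_val i.

Lemma card_plucker_set i : #|plucker_set i| = k.
Proof. by have := enum_valP i; rewrite inE => /eqP. Qed.

(* The s-th smallest element of plucker_set i. *)
Definition plucker_col (i : 'I_nplucker) (s : 'I_k) : 'I_n :=
  enum_val (cast_ord (esym (card_plucker_set i)) s).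

Definition xvar (r : 'I_k) (c : 'I_n) : {mpoly K[k * n]} :=
  'X_(mxvec_index r c).

Definition plucker_minor (i : 'I_nplucker) : {mpoly K[k * n]} :=
  \det (\matrix_(r < k, s < k) xvar r (plucker_col i s)).

Definition plucker_ideal : equations K nplucker :=
  fun p => p \mPo [tuple plucker_minor i | i < nplucker] = 0.

(* The transposition (1 2) of 'S_k; junk value 1 if k < 2. *)
Definition swap12 : 'S_k :=
  match k return 'S_k with
  | k'.+2 => tperm ord0 (inord 1)
  | _ => 1%g
  end.

(* The columns 1, ..., l are the c : 'I_n with c < l. *)
Definition block_matching (l : nat) (i : 'I_nplucker) : 'S_k :=
  if (#|plucker_set i| == 1%N) ||
     (#|plucker_set i :&: [set c : 'I_n | (c < l)%N]| != 1%N)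
  then 1%g else swap12.

Definition matching_term (l : nat) (i : 'I_nplucker) : {mpoly K[k * n]} :=
  let sigma := block_matching l i in
  (-1) ^+ sigma * \prod_(s < k) xvar (sigma s) (plucker_col i s).

Definition matching_ideal (l : nat) : equations K nplucker :=
  fun p => p \mPo [tuple matching_term l i | i < nplucker] = 0.

(* The matrix M_l, with rows and columns numbered from 0; all the truncated
   subtractions below are exact.                                            *)
Definition weight_entry (l : nat) (r : 'I_k) (c : 'I_n) : nat :=
  (match val r with
   | 0 => 0
   | 1 => if c < l then l - c else n + l - c
   | r' => r' * (n - c)
   end)%N.

Definition term_weight (l : nat) (a : 'X_{1..k * n}) : nat :=
  (\sum_(r < k) \sum_(c < n) a (mxvec_index r c) * weight_entry l r c)%N.

Definition plucker_weight (l : nat) (i : 'I_nplucker) : nat :=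
  seq_min [seq term_weight l a | a <- msupp (plucker_minor i)].

End Grassmannian.

Arguments plucker_ideal K k n p : clear implicits.
Arguments matching_ideal K k n l p : clear implicits.
Arguments plucker_weight K k n l i : clear implicits.

(* Main.v *)
(** The minor with column set I has a unique term of least weight, which is the
matching term: a permutation with an inversion not forced by the matching field
can be improved by a transposition. So initial forms of Pluecker relations lie in
the matching ideal, and everything follows if, in each degree d, the products of d
minors span a space whose dimension is the number of monomials that are products
of d matching terms: choosing one product for each such monomial then gives a basis
with distinct leading monomials, the relations expressing the other products in
this basis have as initial forms generators of the matching ideal, and their
homogenizations give a basis of each chart of the family over the polynomials in t.

The dimension is at most the number of standard monomials, by straightening with
Garnir relations. There are at least as many products of d matching terms: given a
semistandard tableau, match the entries of its first two rows as brackets, separately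
among the columns up to l and among those beyond l. Each row 1 entry unmatched on
the left is paired with a row 2 entry unmatched on the right; the matching field
swaps precisely these pairs. The row contents after the swap determine those before
it, because they determine the bracket matching, and the pairs together with the
lower parts of the columns, which have not changed, are columns of a matching field
tableau. The fibres over nonzero points are diagonal coordinate changes of the
Grassmannian. *)

Require Import Defs.
From mathcomp Require Import all_boot all_order all_algebra.
From HB Require Import structures.
From mathcomp Require Import all_fingroup ssrcomplements zify ring.
Set Implicit Arguments.
Unset Strict Implicit.
Unset Printing Implicit Defensive.
Import Order.TTheory GRing.Theory.
Local Open Scope ring_scope.

(** * Diagonal changes of coordinates *)

(** The obstacle is the chart at ['X_i]: setting ['X_i] to 1 must carry a basis to a basis, so
    normal forms have to commute with multiplication by ['X_i]. A single choice of representatives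
    need not do this for every i, so each chart gets its own, with the exponent of ['X_i] as large
    as possible. The weight of a Pluecker monomial is the weight of its leading monomial; hence all
    monomials with the same leading monomial have the same weight, and initial forms treat such a
    class as a whole. Fibres are compared through the vanishing of equations at vectors over
    arbitrary algebras, which suffices for functors of points and avoids comparing ideals. The count
    is made in one degree at a time, as an exchange argument between two finite families of
    polynomials. All this is done for arbitrary polynomials with prescribed leading monomials;
    Grassmannians enter only through the leading terms of minors, straightening, and an injection
    from standard monomials to classes. *)

Section DiagonalAction.
Variables (R : comNzRingType) (N : nat).
Implicit Types (d e : 'I_N -> R) (v : 'rV[R]_N) (S : 'rV[R]_N -> Prop).

Definition dact d v : 'rV[R]_N := \row_j (d j * v 0 j).

Lemma dact_linear d : linear (dact d).
Proof. by move=> a u v; apply/rowP => j; rewrite !mxE mulrDr mulrCA. Qed.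

HB.instance Definition _ d :=
  GRing.isLinear.Build R 'rV[R]_N 'rV[R]_N *:%R (dact d) (dact_linear d).

Lemma dactK d e : (forall j, d j * e j = 1) -> cancel (dact e) (dact d).
Proof. by move=> de v; apply/rowP => j; rewrite !mxE mulrA de mul1r. Qed.

Lemma direct_summand_dact d e S :
    (forall j, d j * e j = 1) -> (forall j, e j * d j = 1) ->
  direct_summand S -> direct_summand (fun v => S (dact d v)).
Proof.
move=> de ed.
have sub S0 : submodule S0 -> submodule (fun v => S0 (dact d v)).
  by case=> S00 SD; split=> [|a u v Su Sv]; rewrite ?linear0 ?linearP //; apply: SD.
case=> subS [S' [subS' S_S' SS']]; split; first exact: sub.
exists (fun v => S' (dact d v)); split; first exact: sub.
  by move=> v Sv S'v; rewrite -[v](dactK ed) (S_S' _ Sv S'v) linear0.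
move=> v; have [u [u' [Su S'u' def_v]]] := SS' (dact d v).
exists (dact e u), (dact e u'); split; rewrite ?(dactK de) //.
by rewrite -linearD /= -def_v (dactK ed).
Qed.

End DiagonalAction.

Lemma map_dact (R R' : comNzRingType) N (h : {rmorphism R -> R'})
    (d : 'I_N -> R) (v : 'rV[R]_N) :
  map_mx h (dact d v) = dact (h \o d) (map_mx h v).
Proof. by apply/rowP => j; rewrite !mxE rmorphM. Qed.

(** The preimage of S under [dact d] is its image under [dact e], so spanning lists are carried over
    in both directions. *)
Lemma pushforward_dact (R R' : comNzRingType) N (h : {rmorphism R -> R'})
    (d e : 'I_N -> R) (S : 'rV[R]_N -> Prop) (v : 'rV[R']_N) :
    (forall j, d j * e j = 1) -> (forall j, e j * d j = 1) ->
  pushforward h (fun u => S (dact d u)) v <->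
  pushforward h S (dact (h \o d) v).
Proof.
move=> de ed.
have hed j : (h \o e) j * (h \o d) j = 1 by rewrite /= -rmorphM ed rmorph1.
split=> -[s sS def_v].
  exists [seq (x.1, dact d x.2) | x <- s].
    by move=> _ /mapP[x xs ->]; apply: sS.
  rewrite def_v linear_sum big_map; apply: eq_bigr => x _ /=.
  by rewrite map_dact linearZ.
exists [seq (x.1, dact e x.2) | x <- s].
  by move=> _ /mapP[x xs ->] /=; rewrite (dactK de); apply: sS.
rewrite -[v](dactK hed) def_v linear_sum big_map; apply: eq_bigr => x _ /=.
by rewrite map_dact linearZ.
Qed.

Lemma proj_space_dact (R : comNzRingType) N (d e : 'I_N -> R)
    (S : 'rV[R]_N -> Prop) :
    (forall j, d j * e j = 1) -> (forall j, e j * d j = 1) ->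
  proj_space S -> proj_space (fun v => S (dact d v)).
Proof.
move=> de ed [dsS lineS]; split; first exact: direct_summand_dact de ed dsS.
move=> F h; have [u u_neq0 defS] := lineS F h.
have hde j : (h \o d) j * (h \o e) j = 1 by rewrite /= -rmorphM de rmorph1.
have hed j : (h \o e) j * (h \o d) j = 1 by rewrite /= -rmorphM ed rmorph1.
exists (dact (h \o e) u).
  by apply: contraNneq u_neq0 => u0; rewrite -[u](dactK hde) u0 linear0.
move=> v; rewrite (pushforward_dact _ _ _ de ed).
split=> [/defS[c dv]|[c ->]]; last first.
  by apply/defS; exists c; rewrite linearZ /= (dactK hde).
by exists c; rewrite -linearZ /= -dv (dactK hed).
Qed.

Definition vanishes (A : comNzRingType) N (E : equations A N) (R : comAlgType A)
    (v : 'rV[R]_N) : Prop :=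
  forall f, E f -> (map_mpoly (in_alg R) f).@[v 0] = 0.

(** The condition on points is imposed vector by vector, so it is enough to compare the equations on
    single vectors over every algebra. *)
Lemma same_subscheme_vanishes (A : comNzRingType) N (E E' : equations A N) :
  (forall (R : comAlgType A) (v : 'rV[R]_N), vanishes E v <-> vanishes E' v) ->
  same_subscheme E E'.
Proof.
move=> EE' R S; split=> -[projS SE]; split=> // f v Ef Sv.
  by have /EE' vE' : vanishes E v by [move=> g Eg; apply: SE]; apply: vE'.
by have /EE' vE : vanishes E' v by [move=> g Eg; apply: SE]; apply: vE.
Qed.

(** The bijection takes preimages under the diagonal map; its scalars come from A, which makes it
    natural in the algebra. *)
Lemma isomorphic_dact (A : comNzRingType) N (E E' : equations A N)
    (d e : 'I_N -> A) :
    (forall j, d j * e j = 1) ->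
    (forall (R : comAlgType A) (v : 'rV[R]_N),
       vanishes E' v <-> vanishes E (dact (in_alg R \o d) v)) ->
  isomorphic E E'.
Proof.
move=> de EE'.
have deR (R : comAlgType A) j : (in_alg R \o d) j * (in_alg R \o e) j = 1.
  by rewrite /= -[LHS](rmorphM (in_alg R)) de rmorph1.
have edR (R : comAlgType A) j : (in_alg R \o e) j * (in_alg R \o d) j = 1.
  by rewrite mulrC deR.
exists (fun (R : comAlgType A) (S : 'rV[R]_N -> Prop) v =>
          S (dact (in_alg R \o d) v)),
       (fun (R : comAlgType A) (S : 'rV[R]_N -> Prop) v =>
          S (dact (in_alg R \o e) v)); split.
- move=> R S [projS SE]; split; last by move=> v; rewrite /= (dactK (deR R)).
  split; first exact: proj_space_dact (deR R) (edR R) projS.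
  move=> f v E'f Sv; suff /(_ f E'f) : vanishes E' v by [].
  by apply/EE' => g Eg; apply: SE.
- move=> R S [projS SE']; split; last by move=> v; rewrite /= (dactK (edR R)).
  split; first exact: proj_space_dact (edR R) (deR R) projS.
  move=> f v Ef Sv; have /EE' : vanishes E' (dact (in_alg R \o e) v).
    by move=> g E'g; apply: SE'.
  by rewrite (dactK (deR R)); apply.
move=> R R' h S _ v; rewrite (pushforward_dact _ _ _ (deR R) (edR R)).
suff -> : dact (in_alg R' \o d) v = dact (h \o (in_alg R \o d)) v by [].
by apply/rowP => j; rewrite !mxE /= linearZ /= rmorph1.
Qed.

(** * Flatness of free modules *)

(** Stated for a bare function because [bilinear_map] gives linearity only as a property of partial
    applications. *)
Lemma linear_combination (R : comNzRingType) (U V : lmodType R) (g : U -> V)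
    (T : Type) (s : seq T) (c : T -> R) (u : T -> U) :
  linear g -> g (\sum_(x <- s) c x *: u x) = \sum_(x <- s) c x *: g (u x).
Proof.
move=> lin_g; elim: s => [|x s IHs]; last by rewrite !big_cons lin_g IHs.
by have := lin_g (-1) 0 0; rewrite !big_nil scaler0 add0r scaleN1r addNr.
Qed.

(* Only the scalar forms of M and finite lists of its elements are involved, so
   no tensor product has to be constructed. *)
Lemma flat_dual_basis (R : comNzRingType) (M : lmodType R) :
    (forall s : seq M, exists t : seq ({scalar M} * M),
       forall x, x \in s -> x = \sum_(y <- t) y.1 x *: y.2) ->
  flat M.
Proof.
move=> basisM N N' f f_inj s fs0 W b [blin blin'].
have [t def_s] := basisM [seq x.2 | x <- s].
(* The vanishing tensor is tested against the bilinear map sending (u, m) to [phi m *: u];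
   injectivity of f brings the identity back to N. *)
have coord0 (phi : {scalar M}) : \sum_(x <- s) phi x.2 *: x.1 = 0.
  apply: f_inj; rewrite linear0 linear_sum.
  rewrite -[RHS](fs0 N' (fun u m => phi m *: u)) ?big_map.
    by apply: eq_bigr => x _; rewrite linearZ.
  split=> [m|u] a x y; first by rewrite scalerDr !scalerA mulrC.
  by rewrite linearP scalerDl scalerA.
have -> : \sum_(x <- s) b x.1 x.2
        = \sum_(x <- s) \sum_(y <- t) y.1 x.2 *: b x.1 y.2.
  rewrite !big_seq; apply: eq_bigr => x xs.
  by rewrite {1}(def_s x.2) ?map_f // linear_combination.
rewrite exchange_big big1 //= => y _.
have sumE := @linear_combination R N W (b^~ y.2) _ _ _ _ (blin y.2).
rewrite -(sumE _ s (fun x => y.1 x.2) (fun x => x.1)) coord0.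
by have := sumE _ [::] (fun=> 0) id; rewrite !big_nil.
Qed.

(** * Free modules of polynomials with prescribed monomials *)

Section SupportModule.
Variables (R : comNzRingType) (N : nat) (B : pred 'X_{1..N}).

Definition supported : {pred {mpoly R[N]}} := fun p => all B (msupp p).

Lemma supportedP p :
  reflect (forall a, ~~ B a -> p@_a = 0) (p \in supported).
Proof.
apply: (iffP allP) => [Bp a|Bp a].
  by apply: contraNeq; rewrite -mcoeff_msupp; apply: Bp.
by rewrite mcoeff_msupp; apply: contraNT => /Bp ->.
Qed.

Lemma supported_submod_closed : submod_closed supported.
Proof.
split=> [|a p q /supportedP Bp /supportedP Bq].
  by apply/supportedP => a _; rewrite mcoeff0.
by apply/supportedP => b nBb; rewrite mcoeffD mcoeffZ Bp // Bq // mulr0 addr0.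
Qed.

HB.instance Definition _ :=
  GRing.isSubmodClosed.Build R {mpoly R[N]} supported supported_submod_closed.

Record supp_mod := SuppMod {
  supp_val :> {mpoly R[N]};
  _ : supp_val \in supported
}.

HB.instance Definition _ := [isSub for supp_val].
HB.instance Definition _ := [Choice of supp_mod by <:].
HB.instance Definition _ := [SubChoice_isSubLmodule of supp_mod by <:].

Definition supp_coef (a : 'X_{1..N}) : supp_mod -> R := mcoeff a \o supp_val.

Lemma supp_coef_linear a : linear_for *%R (supp_coef a).
Proof. by move=> c p q; rewrite /supp_coef /= linearP. Qed.

HB.instance Definition _ a :=
  GRing.isLinear.Build R supp_mod R *%R (supp_coef a) (supp_coef_linear a).

Lemma supp_mod_flat : flat supp_mod.
Proof.
apply: flat_dual_basis => s.
have inB (a : 'X_{1..N}) : B a -> 'X_[R, a] \in supported.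
  by move=> Ba; rewrite unfold_in msuppX /= Ba.
exists [seq (supp_coef a : {scalar supp_mod}, insubd 0 'X_[R, a])
         | a <- undup (flatten [seq msupp (supp_val x) | x <- s]) & B a].
move=> x xs; apply/val_inj.
rewrite big_map big_filter raddf_sum /= -[LHS]/(supp_val x).
set r := undup _.
have sub_r : {subset msupp (supp_val x) <= r}.
  by move=> a ax; rewrite mem_undup; apply/flatten_mapP; exists x.
transitivity (\sum_(a <- r | B a) (supp_val x)@_a *: 'X_[R, a]); last first.
  apply: eq_bigr => a Ba; rewrite -[supp_val (insubd _ _)]/(val _).
  by rewrite insubdK //; apply: inB.
apply/mpolyP => a; rewrite raddf_sum /=.
have coefE b : ((supp_val x)@_b *: 'X_[R, b])@_a
             = if b == a then (supp_val x)@_a else 0.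
  by rewrite mcoeffZ mcoeffX; case: eqP => [->|]; rewrite ?mulr1 ?mulr0.
rewrite (eq_bigr _ (fun b _ => coefE b)) -big_mkcondr /=.
have [ax|nax] := boolP (a \in msupp x).
  have Ba : B a by apply: (allP (valP x)).
  rewrite -big_filter (_ : [seq b <- r | B b && (b == a)] = [:: a]) ?big_seq1 //.
  rewrite (@eq_filter _ _ (pred1 a)); last first.
    by move=> b; rewrite /= andbC; case: eqP => [->|].
  by rewrite filter_pred1_uniq ?undup_uniq // sub_r.
by rewrite memN_msupp_eq0 // big1 // => b /andP[_ /eqP->]; rewrite memN_msupp_eq0.
Qed.

End SupportModule.

(** * Linear algebra *)

(** A relation among the rows of the matrix expressing B in S would be a relation among the vectors
    of B. So its rank is [#|B|], at least its number of columns, and the rows of a left inverse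
    express S in B. Vectors are indexed by F, so S may contain repetitions. *)
Lemma steinitz_exchange (K : fieldType) (V : lmodType K) (F : finType)
    (b : F -> V) (B S : {set F}) :
    (forall c : F -> K, \sum_(x in B) c x *: b x = 0 ->
       forall x, x \in B -> c x = 0) ->
    (forall x, x \in B -> exists c : F -> K, b x = \sum_(y in S) c y *: b y) ->
    (#|S| <= #|B|)%N ->
  forall y, y \in S -> exists c : F -> K, b y = \sum_(x in B) c x *: b x.
Proof.
move=> indepB spanS leSB.
have /fin_all_exists[C defC] : forall x, exists c : F -> K,
    x \in B -> b x = \sum_(y in S) c y *: b y.
  move=> x; have [/spanS[c def_x]|_] := boolP (x \in B); first by exists c.
  by exists (fun=> 0).
pose A := \matrix_(i < #|B|, j < #|S|) C (enum_val i) (enum_val j).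
have defA i : b (enum_val i) = \sum_j A i j *: b (enum_val j).
  rewrite defC ?enum_valP // big_enum_val.
  by apply: eq_bigr => j _; rewrite mxE.
have combA k (D : 'M[K]_(k, #|B|)) r :
    \sum_i D r i *: b (enum_val i) = \sum_j (D *m A) r j *: b (enum_val j).
  under eq_bigr => i _ do rewrite defA scaler_sumr.
  rewrite exchange_big; apply: eq_bigr => j _ /=.
  by rewrite mxE scaler_suml; apply: eq_bigr => i _; rewrite scalerA.
have freeA : row_free A.
  rewrite -kermx_eq0; apply/rowV0P => u /sub_kermxP uA0; apply/rowP => i.
  rewrite mxE; pose c x := \sum_(i < #|B| | enum_val i == x) u 0 i.
  have cE j : c (enum_val j) = u 0 j.
    rewrite /c (eq_bigl (pred1 j)) ?big_pred1_eq // => i'.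
    by rewrite /= (inj_eq enum_val_inj).
  rewrite -cE; apply: indepB; last exact: enum_valP.
  rewrite big_enum_val; under eq_bigr => j _ do rewrite cE.
  by rewrite combA uA0 big1 // => j _; rewrite mxE scale0r.
have /row_fullP[D DA1] : row_full A.
  by rewrite /row_full eqn_leq rank_leq_col (leq_trans leSB) // (eqP freeA).
move=> y yS; pose r := enum_rank_in yS y.
exists (fun x => \sum_(i < #|B| | enum_val i == x) D r i).
transitivity (\sum_i D r i *: b (enum_val i)).
  rewrite combA DA1 (bigD1 r) //= mxE eqxx scale1r enum_rankK_in //.
  rewrite big1 ?addr0 // => j j_r; rewrite mxE eq_sym (negPf j_r) scale0r //.
rewrite [RHS]big_enum_val; apply: eq_bigr => i _; congr (_ *: _).
rewrite (eq_bigl (pred1 i)) ?big_pred1_eq // => i'.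
by rewrite /= (inj_eq enum_val_inj).
Qed.

Section LinearExtension.
Variables (R : nzRingType) (N : nat) (V : lmodType R) (g : 'X_{1..N} -> V).

Definition mlin (p : {mpoly R[N]}) : V := \sum_(a <- msupp p) p@_a *: g a.

Lemma mlin_widen k p :
  (msize p <= k)%N -> mlin p = \sum_(a : 'X_{1..N < k}) p@_a *: g a.
Proof.
move=> le_pk; rewrite /mlin (big_mksub 'X_{1..N < k}) ?msupp_uniq //=.
  rewrite big_rmcond //= => a /memN_msupp_eq0 ->; exact: scale0r.
by move=> a /msize_mdeg_lt /leq_trans; apply.
Qed.

Lemma mlin_linear : linear mlin.
Proof.
move=> c p q; pose k := maxn (msize (c *: p + q)) (maxn (msize p) (msize q)).
rewrite !(@mlin_widen k) ?leq_max ?leqnn ?orbT // scaler_sumr -big_split /=.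
by apply: eq_bigr => a _; rewrite mcoeffD mcoeffZ scalerDl scalerA.
Qed.

HB.instance Definition _ :=
  GRing.isLinear.Build R {mpoly R[N]} V *:%R mlin mlin_linear.

Lemma mlinX a : mlin 'X_[a] = g a.
Proof. by rewrite /mlin msuppX big_seq1 mcoeffX eqxx scale1r. Qed.

End LinearExtension.

(** * Degenerations defined by leading monomials *)

Lemma mmap1D (R : comNzRingType) N (h : 'I_N -> R) (b c : 'X_{1..N}) :
  mmap1 h (b + c)%MM = mmap1 h b * mmap1 h c.
Proof. by rewrite commr_mmap1_M // => i x; apply: mulrC. Qed.

Lemma map_mpoly_comb (R S : comNzRingType) N (h : {rmorphism R -> S}) (I : Type)
    (s : seq I) (c : I -> R) (b : I -> 'X_{1..N}) :
  map_mpoly h (\sum_(i <- s) c i *: 'X_[b i]) = \sum_(i <- s) h (c i) *: 'X_[b i].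
Proof.
rewrite (raddf_sum (map_mpoly h)); apply: eq_bigr => i _ /=.
by rewrite map_mpolyZ map_mpolyX.
Qed.

Lemma meval_comb (R : comNzRingType) N (v : 'I_N -> R) (I : Type)
    (s : seq I) (c : I -> R) (b : I -> 'X_{1..N}) :
  (\sum_(i <- s) c i *: 'X_[b i]).@[v] = \sum_(i <- s) c i * mmap1 v (b i).
Proof.
rewrite (raddf_sum (meval v)); apply: eq_bigr => i _ /=.
by rewrite mevalZ mevalX.
Qed.

Lemma big_msupp_mcoeff (R : nzRingType) N (f : {mpoly R[N]}) (P : pred 'X_{1..N})
    (F : 'X_{1..N} -> R) b :
    (forall c, c \in msupp f -> P c -> c = b) -> P b ->
  \sum_(c <- msupp f | P c) f@_c * F c = f@_b * F b.
Proof.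
move=> Pb1 Pb; have [bf|nbf] := boolP (b \in msupp f); last first.
  rewrite (memN_msupp_eq0 nbf) mul0r big_seq_cond big1 // => c /andP[cf Pc].
  by case/negP: nbf; rewrite -(Pb1 c).
rewrite big_mkcond (bigD1_seq b) ?msupp_uniq //= Pb big_seq_cond big1 ?addr0 //.
by move=> c /andP[cf /eqP cb]; case: ifP => // Pc; case: cb; apply: Pb1.
Qed.

Lemma seq_minP (s : seq nat) x :
  x \in s -> seq_min s \in s /\ (seq_min s <= x)%N.
Proof.
have min_le z (r : seq nat) y : y \in r -> (\big[minn/z]_(i <- r) i <= y)%N.
  elim: r => // y' r IHr; rewrite inE big_cons => /orP[/eqP->|/IHr]; first exact: geq_minl.
  exact/leq_trans/geq_minr.
have min_in z (r : seq nat) : \big[minn/z]_(i <- r) i \in z :: r.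
  elim: r => [|y r IHr]; first by rewrite big_nil mem_head.
  rewrite big_cons /minn; case: ifP => _; rewrite ?inE ?eqxx ?orbT //.
  by move: IHr; rewrite !inE => /orP[]->; rewrite ?orbT.
move=> xs; split; last exact: min_le.
by case: s xs (min_in (head 0%N s) s) => // y s _; rewrite /seq_min !inE orbA orbb.
Qed.

(** * Leading monomials for an additive weight *)

Section LeadingMonomials.
Variables (K : fieldType) (m : nat) (wt : 'X_{1..m} -> nat).
Hypothesis wtD : forall u v, wt (u + v)%MM = (wt u + wt v)%N.
Implicit Types (q r : {mpoly K[m]}) (u v : 'X_{1..m}).

Definition high k d q :=
  forall v, v \in msupp q -> (k <= wt v)%N /\ mdeg v = d.

Lemma highD k d q r : high k d q -> high k d r -> high k d (q + r).
Proof.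
by move=> hq hr v /msuppD_le; rewrite mem_cat => /orP[/hq|/hr].
Qed.

Lemma highM k k' d d' q r :
  high k d q -> high k' d' r -> high (k + k') (d + d') (q * r).
Proof.
move=> hq hr v /msuppM_le/allpairsP[[u u'] /= [/hq[ku du] /hr[ku' du'] ->]].
by rewrite wtD mdegD du du' leq_add.
Qed.

Lemma highX c u : high (wt u) (mdeg u) (c *: 'X_[u]).
Proof. by move=> v /msuppZ_le/mem_msuppXP <-. Qed.

(* All the remaining terms of q have a larger weight than u; they also have the
   same degree as u, so that classes of monomials remember degrees. *)
Definition is_lead q u (c : K) :=
  high (wt u).+1 (mdeg u) (q - c *: 'X_[u]).

Lemma high_lead q u c : is_lead q u c -> high (wt u) (mdeg u) q.
Proof.
move=> lq; rewrite -(subrK (c *: 'X_[u]) q); apply: highD; last exact: highX.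
by move=> v /lq[/ltnW].
Qed.

Lemma is_lead1 : is_lead 1 0%MM 1.
Proof. by move=> v; rewrite mpolyX0 scale1r subrr msupp0. Qed.

Lemma is_leadM q r u v c d :
  is_lead q u c -> is_lead r v d -> is_lead (q * r) (u + v)%MM (c * d).
Proof.
move=> lq lr; rewrite /is_lead.
have -> : q * r - (c * d) *: 'X_[(u + v)%MM]
        = (q - c *: 'X_[u]) * r + c *: 'X_[u] * (r - d *: 'X_[v]).
  rewrite mulrBl mulrBr addrA subrK; congr (_ - _).
  by rewrite -scalerAl -scalerAr scalerA mpolyXD.
rewrite wtD mdegD; apply: highD; first exact: highM lq (high_lead lr).
by rewrite -addnS; apply: highM lr; apply: highX.
Qed.

Lemma is_lead_prod (I : Type) (s : seq I) (f : I -> {mpoly K[m]}) (u : I -> 'X_{1..m})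
    (c : I -> K) :
    (forall i, is_lead (f i) (u i) (c i)) ->
  is_lead (\prod_(i <- s) f i) (\sum_(i <- s) u i)%MM (\prod_(i <- s) c i).
Proof.
move=> lf; elim: s => [|i s IHs]; last by rewrite !big_cons; apply: is_leadM.
by rewrite !big_nil; apply: is_lead1.
Qed.

Lemma is_leadX q u c k : is_lead q u c -> is_lead (q ^+ k) (u *+ k)%MM (c ^+ k).
Proof.
move=> lq; elim: k => [|k IHk]; first by rewrite !expr0 mulm0n; apply: is_lead1.
by rewrite !exprS mulmS; apply: is_leadM.
Qed.

Lemma mcoeff_lead q u c v :
  is_lead q u c -> (wt v <= wt u)%N -> q@_v = c * (u == v)%:R.
Proof.
move=> lq le_vu; rewrite -(subrK (c *: 'X_[u]) q) mcoeffD mcoeffZ mcoeffX.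
rewrite (@memN_msupp_eq0 _ _ _ v) ?add0r //.
by apply/negP => /lq[]; rewrite ltnNge le_vu.
Qed.

End LeadingMonomials.

Section GeneratedIdeal.
Variables (R : comNzRingType) (E : R -> Prop).

Lemma ideal_gen_mem x y : E y -> ideal_gen E (x * y).
Proof.
by exists [:: (x, y)]; rewrite ?big_seq1 // => z; rewrite inE => /eqP->.
Qed.

Lemma ideal_gen0 : ideal_gen E 0.
Proof. by exists [::]; rewrite ?big_nil. Qed.

Lemma ideal_genD x y : ideal_gen E x -> ideal_gen E y -> ideal_gen E (x + y).
Proof.
case=> s sE -> [t tE ->]; exists (s ++ t); last by rewrite big_cat.
by move=> z; rewrite mem_cat => /orP[/sE|/tE].
Qed.

Lemma ideal_genM x y : ideal_gen E y -> ideal_gen E (x * y).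
Proof.
case=> s sE ->; rewrite mulr_sumr; elim: s sE => [|z s IHs] sE.
  by rewrite big_nil; apply: ideal_gen0.
rewrite big_cons mulrA; apply: ideal_genD.
  by apply: ideal_gen_mem; apply: sE; rewrite mem_head.
by apply: IHs => t ts; apply: sE; rewrite inE ts orbT.
Qed.

Lemma ideal_gen_sum (I : Type) (s : seq I) (F : I -> R) :
  (forall i, ideal_gen E (F i)) -> ideal_gen E (\sum_(i <- s) F i).
Proof.
by move=> EF; apply: big_ind => //; [apply: ideal_gen0|apply: ideal_genD].
Qed.

End GeneratedIdeal.

(** * Relations among polynomials with prescribed leading monomials *)

Section Sagbi.
Variables (K : fieldType) (N m : nat) (wt : 'X_{1..m} -> nat).
Variables (p : 'I_N -> {mpoly K[m]}) (a : 'I_N -> 'X_{1..m}) (eps : 'I_N -> K).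
Variables (w : 'I_N -> nat) (e : nat).
Hypothesis wE : forall i, w i = wt (a i).
Hypothesis wtD : forall u v, wt (u + v)%MM = (wt u + wt v)%N.
Hypothesis e_gt0 : (0 < e)%N.
Hypothesis mdeg_a : forall i, mdeg (a i) = e.
Hypothesis eps_neq0 : forall i, eps i != 0.
Hypothesis lead_p : forall i, is_lead wt (p i) (a i) (eps i).
Implicit Types (f q : {mpoly K[N]}) (b c : 'X_{1..N}) (u v : 'X_{1..m}).

(* The leading monomial of the value at p of the monomial 'X_[b]. *)
Definition cls b : 'X_{1..m} := (\sum_(i < N) a i *+ b i)%MM.

Lemma clsD b c : cls (b + c)%MM = (cls b + cls c)%MM.
Proof.
apply/mnmP => j; rewrite mnmDE !mnm_sumE -big_split /=.
by apply: eq_bigr => i _; rewrite !mulmnE mnmDE mulnDr.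
Qed.

Lemma cls1 i : cls U_(i)%MM = a i.
Proof.
apply/mnmP => j; rewrite mnm_sumE (bigD1 i) //= mulmnE mnm1E eqxx muln1.
by rewrite big1 ?addn0 // => i' i'i; rewrite mulmnE mnm1E eq_sym (negPf i'i) muln0.
Qed.

Lemma mdeg_cls b : mdeg (cls b) = (e * mdeg b)%N.
Proof.
rewrite mdeg_sum mdegE big_distrr; apply: eq_bigr => i _ /=.
by rewrite mdegMn mdeg_a.
Qed.

Lemma cls_mdeg b c : cls b = cls c -> mdeg b = mdeg c.
Proof.
by move/(congr1 (@mdeg m)); rewrite !mdeg_cls => /eqP; rewrite eqn_pmul2l // => /eqP.
Qed.

Lemma eps_mon_neq0 b : mmap1 eps b != 0.
Proof. by apply/prodf_neq0 => i _; apply: expf_neq0. Qed.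

Lemma lead_mon b : is_lead wt (mmap1 p b) (cls b) (mmap1 eps b).
Proof.
by apply: (is_lead_prod wtD) => i; apply: (is_leadX wtD); apply: lead_p.
Qed.

(** The weight depends only on the class, so t-homogenization multiplies a whole class by one power
    of t. *)
Lemma mweight_cls b : mweight w b = wt (cls b).
Proof.
have wt0 : wt 0%MM = 0%N.
  by apply: (@addnI (wt 0%MM)); rewrite addn0 -wtD addm0.
rewrite /mweight /cls (big_morph wt wtD wt0); apply: eq_bigr => i _; rewrite wE.
by elim: (b i) => [|k IHk]; rewrite ?mulm0n // mulSn mulmS wtD IHk.
Qed.

Let ev f := f \mPo [tuple p i | i < N].

Lemma ev_mon f : ev f = \sum_(b <- msupp f) f@_b *: mmap1 p b.
Proof.
rewrite /ev comp_mpolyE; apply: eq_bigr => b _; congr (_ *: _).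
by apply: eq_bigr => i _; rewrite tnth_mktuple.
Qed.

Lemma evX b : ev 'X_[b] = mmap1 p b.
Proof. by rewrite ev_mon msuppX big_seq1 mcoeffX eqxx scale1r. Qed.

(** The coefficient at u of the value of f when each variable is replaced by the leading term [eps i
    *: 'X_[a i]]. *)
Definition cls_form u : {mpoly K[N]} -> K^o :=
  @mlin K N K^o (fun b => (cls b == u)%:R * mmap1 eps b).

(** A monomial whose class weighs at least [wt u] reaches u only through its leading term, its other
    terms being heavier. *)
Lemma mcoeff_ev f u :
    (forall b, b \in msupp f -> wt u <= wt (cls b))%N ->
  (ev f)@_u = cls_form u f.
Proof.
move=> le_u; rewrite ev_mon raddf_sum /cls_form /mlin !big_seq /=.
apply: eq_bigr => b bf; rewrite mcoeffZ (mcoeff_lead (@lead_mon b)) ?le_u //.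
by rewrite [_%:R * _]mulrC.
Qed.

Definition initial_ideal : equations K N :=
  fun f => f \mPo [tuple eps i *: 'X_[a i] | i < N] = 0.

Lemma initial_idealP f : initial_ideal f <-> forall u, cls_form u f = 0.
Proof.
have coefE u : (f \mPo [tuple eps i *: 'X_[a i] | i < N])@_u = cls_form u f.
  rewrite comp_mpolyE raddf_sum; apply: eq_bigr => b _ /=.
  have -> : \prod_(i < N) tnth [tuple eps i *: 'X_[a i] | i < N] i ^+ b i =
            mmap1 eps b *: 'X_[cls b].
    rewrite -mprodXE -scaler_prod; apply: eq_bigr => i _.
    by rewrite tnth_mktuple exprZn mpolyXn.
  by rewrite !mcoeffZ mcoeffX [mmap1 _ _ * _]mulrC.
split=> [Jf u|f0]; first by rewrite -coefE Jf mcoeff0.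
by apply/mpolyP => u; rewrite coefE f0 mcoeff0.
Qed.

Section NormalForms.
(* The normal monomials represent each class once; which representatives are
   chosen will depend on the chart. *)
Variable nb : pred 'X_{1..N}.
Hypothesis nb_inj : forall b c, nb b -> nb c -> cls b = cls c -> b = c.
Hypothesis nb_span : forall b, exists q,
  ev q = mmap1 p b /\ forall c, c \in msupp q -> nb c /\ mdeg c = mdeg b.

Lemma exists_min_weight f :
  f != 0 -> exists2 b, b \in msupp f &
    forall c, c \in msupp f -> (wt (cls b) <= wt (cls c))%N.
Proof.
rewrite -msupp_eq0; case: (msupp f) => // b s _; elim: s b => [|c s IHs] b.
  by exists b => [|c]; rewrite inE // => /eqP->.
have [d ds le_d] := IHs b; have [le_dc|lt_cd] := leqP (wt (cls d)) (wt (cls c)).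
  exists d => [|x]; rewrite !inE; first by move: ds; rewrite !inE => /orP[]->; rewrite ?orbT.
  case/or3P=> [/eqP->|/eqP->|xs] //; rewrite le_d ?inE ?eqxx ?xs ?orbT //.
exists c => [|x]; rewrite !inE ?eqxx ?orbT //.
by case/or3P=> [xb|/eqP->|xs] //; apply: (leq_trans (ltnW lt_cd));
   rewrite le_d ?inE ?xb ?xs ?orbT.
Qed.

(** No other normal monomial lies in the class of b, so nothing cancels its leading term. *)
Lemma mcoeff_ev_normal q b :
    (forall c, c \in msupp q -> nb c) -> nb b ->
    (forall c, c \in msupp q -> wt (cls b) <= wt (cls c))%N ->
  (ev q)@_(cls b) = q@_b * mmap1 eps b.
Proof.
move=> nbq nbb le_b; rewrite mcoeff_ev // /cls_form /mlin.
under eq_bigr => c _ do rewrite [_ *: _]mulrCA mulr_natl mulrb.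
rewrite -big_mkcond /=; apply: big_msupp_mcoeff => // c cq /eqP.
by apply: nb_inj => //; apply: nbq.
Qed.

Lemma normal_form_eq0 q : (forall c, c \in msupp q -> nb c) -> ev q = 0 -> q = 0.
Proof.
move=> nbq evq0; apply/eqP; apply: contraT => /exists_min_weight[b bq le_b].
move: (bq); rewrite mcoeff_msupp -(mulIr_eq0 _ (mulIf (eps_mon_neq0 b))).
by rewrite -mcoeff_ev_normal ?nbq // evq0 mcoeff0 eqxx.
Qed.

Lemma normal_form_inj q q' :
    (forall c, c \in msupp q -> nb c) -> (forall c, c \in msupp q' -> nb c) ->
  ev q = ev q' -> q = q'.
Proof.
move=> nbq nbq' eq_ev; apply/eqP; rewrite -subr_eq0; apply/eqP.
apply: normal_form_eq0; last by rewrite /ev linearB /= -!/(ev _) eq_ev subrr.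
by move=> c /msuppB_le; rewrite mem_cat => /orP[/nbq|/nbq'].
Qed.

(** A boolean form of [nb_span], from which [xchoose] extracts normal forms as a function. *)
Lemma ex_nf b : exists q,
  (ev q == mmap1 p b) && all (fun c => nb c && (mdeg c == mdeg b)) (msupp q).
Proof.
have [q [evq nbq]] := nb_span b; exists q; rewrite evq eqxx.
by apply/allP => c /nbq[-> ->] /=.
Qed.

Definition nf b : {mpoly K[N]} := xchoose (ex_nf b).

Lemma ev_nf b : ev (nf b) = mmap1 p b.
Proof. by have /andP[/eqP] := xchooseP (ex_nf b). Qed.

Lemma nf_normal b c : c \in msupp (nf b) -> nb c.
Proof.
by have /andP[_ /allP nbq] := xchooseP (ex_nf b) => /nbq/andP[].
Qed.

Lemma nf_id b : nb b -> nf b = 'X_[b].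
Proof.
move=> nbb; apply: normal_form_inj; first exact: nf_normal.
  by move=> c /mem_msuppXP <-.
by rewrite ev_nf evX.
Qed.

(** The lightest terms of the normal form survive in its value, which is the value of b; up to
    weight [wt (cls b)], that value contains no monomial but [cls b]. *)
Lemma wt_nf b c : c \in msupp (nf b) ->
  (wt (cls b) <= wt (cls c))%N /\ (wt (cls b) = wt (cls c) -> cls b = cls c).
Proof.
move=> c_nf; have [d d_nf le_d] : exists2 d, d \in msupp (nf b) &
    forall c, c \in msupp (nf b) -> (wt (cls d) <= wt (cls c))%N.
  by apply: exists_min_weight; apply: contraTneq c_nf => ->; rewrite msupp0.
have minE d' : d' \in msupp (nf b) -> (wt (cls d') <= wt (cls d))%N ->
    (wt (cls b) <= wt (cls d'))%N /\ (wt (cls b) = wt (cls d') -> cls b = cls d').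
  move=> d'_nf le_d'd.
  have : (mmap1 p b)@_(cls d') != 0.
    rewrite -ev_nf mcoeff_ev_normal ?(nf_normal d'_nf) //; last 1 first.
    - by move=> c' /le_d; apply: leq_trans.
    - by rewrite mulf_neq0 ?eps_mon_neq0 // -mcoeff_msupp.
    - by move=> c'; apply: nf_normal.
  have [le_d'b|lt_bd'] := leqP (wt (cls d')) (wt (cls b)); last first.
    by rewrite (ltnW lt_bd') => _; split=> // eq_wt; rewrite eq_wt ltnn in lt_bd'.
  rewrite (mcoeff_lead (@lead_mon b)) //.
  by case: (cls b =P cls d') => [->//|]; rewrite mulr0 eqxx.
have [le_bd _] := minE d d_nf (leqnn _).
(* If the weights agree, c is itself among the lightest terms. *)
split=> [|eq_wt]; first exact: leq_trans le_bd (le_d c c_nf).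
by have [] := minE c c_nf; [rewrite -eq_wt|move=> _; apply].
Qed.

Lemma mcoeff_nf b c : nb c -> cls c = cls b ->
  (nf b)@_c = mmap1 eps b / mmap1 eps c.
Proof.
move=> nbc eq_cls; apply: canRL (mulfK (eps_mon_neq0 c)) _.
rewrite -mcoeff_ev_normal ?eq_cls //; last by move=> c' /wt_nf[].
  by rewrite ev_nf (mcoeff_lead (@lead_mon b)) // eqxx mulr1.
by move=> c'; apply: nf_normal.
Qed.

(* The t-homogenization of f, up to a power of t; the exponents are truncated,
   so that this is only meaningful if k is a lower bound for the weights in f. *)
Definition level k f : {mpoly {poly K}[N]} :=
  \sum_(b <- msupp f) (f@_b *: 'X^(wt (cls b) - k)) *: 'X_[{poly K}, b].

Lemma mcoeff_level k f b : (level k f)@_b = f@_b *: 'X^(wt (cls b) - k).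
Proof.
rewrite /level raddf_sum /=; have [bf|nbf] := boolP (b \in msupp f).
  rewrite (bigD1_seq b) ?msupp_uniq //= mcoeffZ mcoeffX eqxx mulr1 big1 ?addr0 //.
  by move=> c cb; rewrite mcoeffZ mcoeffX (negPf cb) mulr0.
rewrite (memN_msupp_eq0 nbf) scale0r big_seq big1 // => c cf.
rewrite mcoeffZ mcoeffX; case: eqP => [cb|_]; rewrite ?mulr0 //.
by rewrite -cb cf in nbf.
Qed.

Let G : equations K N := fun f => ev f = 0.
Let Y := groebner_family w G.

Lemma homogenization_level f : homogenization w f = level (min_weight w f) f.
Proof. by apply: eq_bigr => b _; rewrite mweight_cls. Qed.

Lemma min_weight_le f b : b \in msupp f -> (min_weight w f <= wt (cls b))%N.
Proof.
move=> bf; rewrite -mweight_cls /min_weight.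
have : mweight w b \in [seq mweight w c | c <- msupp f] by apply: map_f.
by move=> /seq_minP[].
Qed.

Lemma min_weight_ge k f :
    (forall b, b \in msupp f -> k <= wt (cls b))%N -> f != 0 ->
  (k <= min_weight w f)%N.
Proof.
move=> le_k; rewrite -msupp_eq0 /min_weight => f_neq0.
have : seq_min [seq mweight w b | b <- msupp f] \in [seq mweight w b | b <- msupp f].
  by case: (msupp f) f_neq0 => // b s _; have /seq_minP[] := mem_head (mweight w b) (map (mweight w) s).
by case/mapP => b /le_k; rewrite -mweight_cls => le_kb ->.
Qed.

(** A relation may be homogenized from any lower bound k of its weights: this only costs a power of
    t, so the result stays in the ideal of the family. *)
Lemma level_homogenization k f :
    (forall b, b \in msupp f -> k <= wt (cls b))%N ->
  level k f = 'X^(min_weight w f - k) *: homogenization w f.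
Proof.
move=> le_k; have [->|f_neq0] := eqVneq f 0.
  by rewrite /homogenization /level !msupp0 !big_nil scaler0.
apply/mpolyP => b; rewrite homogenization_level mcoeffZ !mcoeff_level.
have [bf|/memN_msupp_eq0->] := boolP (b \in msupp f); last first.
  by rewrite !scale0r mulr0.
rewrite -scalerAr -exprD; congr (_ *: 'X^_).
have := min_weight_ge le_k f_neq0; have := min_weight_le bf; lia.
Qed.

(** If k is a lower bound for the weights in f, this is the part of f of weight exactly k, possibly
    zero. *)
Definition initial_part k f : {mpoly K[N]} := map_mpoly (eval_at 0) (level k f).

Lemma mcoeff_initial_part k f b :
  (initial_part k f)@_b = f@_b * (wt (cls b) <= k)%:R.
Proof.
rewrite mcoeff_map_mpoly mcoeff_level /= /horner_eval.
by rewrite hornerZ hornerXn expr0n subn_eq0.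
Qed.

(** In the value of f, the coefficient at a leading monomial of least weight receives nothing from
    heavier classes; it is a class sum, and it vanishes because f is a relation. *)
Lemma fibre0_initial_ideal q : fibre0 Y q -> initial_ideal q.
Proof.
case=> _ [f Gf ->] ->; apply/initial_idealP => u.
rewrite homogenization_level -/(initial_part _ f).
set k := min_weight w f.
(* The monomials of a class share their weight, so the initial part keeps or drops the class as a
   whole. *)
have -> : cls_form u (initial_part k f) = (wt u <= k)%:R * cls_form u f.
  rewrite /cls_form (@mlin_widen _ _ _ _ (maxn (msize (initial_part k f)) (msize f)))
    ?leq_maxl // (@mlin_widen _ _ _ _ (maxn (msize (initial_part k f)) (msize f)))
    ?leq_maxr // mulr_sumr.
  apply: eq_bigr => b _; rewrite mcoeff_initial_part.
  case: (cls b =P u) => [<-|_]; last by rewrite !mul0r !scaler0 mulr0.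
  by rewrite [_ * (_ <= _)%:R]mulrC -scalerA.
case: leqP => [le_uk|]; last by rewrite mul0r.
rewrite -mcoeff_ev ?Gf ?mcoeff0 ?mulr0 // => b /min_weight_le.
exact: leq_trans.
Qed.

Lemma vanishes_initial_part (R : comAlgType K) (x : 'rV[R]_N) k f :
    vanishes (fibre0 Y) x -> G f ->
    (forall b, b \in msupp f -> k <= wt (cls b))%N ->
  (map_mpoly (in_alg R) (initial_part k f)).@[x 0] = 0.
Proof.
move=> xY Gf le_k; rewrite /initial_part level_homogenization // !map_mpolyZ mevalZ.
rewrite xY ?mulr0 //; exists (homogenization w f) => //; by exists f.
Qed.

Lemma ev_sub_nf b : G ('X_[b] - nf b).
Proof. by rewrite /G /ev linearB /= -!/(ev _) evX ev_nf subrr. Qed.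

Lemma wt_sub_nf b c : c \in msupp ('X_[b] - nf b) -> (wt (cls b) <= wt (cls c))%N.
Proof.
by move=> /msuppB_le; rewrite mem_cat => /orP[/mem_msuppXP->//|/wt_nf[]].
Qed.

Lemma vanishes_fibre0 (R : comAlgType K) (x : 'rV[R]_N) :
  vanishes (fibre0 Y) x <-> vanishes initial_ideal x.
Proof.
split=> [xY f /initial_idealP f0|xJ q /fibre0_initial_ideal]; last exact: xJ.
pose g b := initial_part (wt (cls b)) ('X_[b] - nf b).
(* Coefficients are compared at each c. If c is not normal, only b = c contributes. If c is normal,
   the normal forms contribute the class sum of f at [cls c] divided by [mmap1 eps c], which is
   zero. *)
have -> : f = \sum_(b <- msupp f) f@_b *: g b.
  apply/mpolyP => c; rewrite raddf_sum /= {1}(mpolyE f) raddf_sum /=.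
  apply/eqP; rewrite -subr_eq0 -sumrB; apply/eqP.
  have [nbc|nnbc] := boolP (nb c); last first.
    apply: big1 => b _; rewrite !mcoeffZ mcoeff_initial_part mcoeffB.
    rewrite (@memN_msupp_eq0 _ _ (nf b) c); last exact: contra (@nf_normal b c) nnbc.
    by rewrite subr0 mcoeffX; case: eqP => [->|]; rewrite ?leqnn ?mulr1 ?mul0r ?subrr.
  transitivity (cls_form (cls c) f / mmap1 eps c); last by rewrite f0 mul0r.
  rewrite /cls_form /mlin mulr_suml; apply: eq_bigr => b _.
  rewrite !mcoeffZ mcoeff_initial_part mcoeffB -mulrBr -[RHS]mulrA; congr (_ * _).
  rewrite mcoeffX mulrBl.
  have -> : (b == c)%:R * (wt (cls c) <= wt (cls b))%:R = (b == c)%:R :> K.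
    by case: eqP => [->|]; rewrite ?leqnn ?mulr1 ?mul0r.
  rewrite opprB addrC subrK.
  case: (cls b =P cls c) => [eq_cls|neq_cls].
    by rewrite mcoeff_nf // eq_cls leqnn mulr1 mul1r.
  rewrite !mul0r; have [c_nf|/memN_msupp_eq0->] := boolP (c \in msupp (nf b)).
    have [le_bc eq_bc] := wt_nf c_nf; rewrite leqNgt ltn_neqAle le_bc andbT.
    by case: eqP => [/eq_bc|] //=; rewrite mulr0.
  by rewrite mul0r.
rewrite (raddf_sum (map_mpoly (in_alg R))) (raddf_sum (meval (x 0))) big1 //= => b _.
rewrite map_mpolyZ mevalZ vanishes_initial_part ?mulr0 //; first exact: ev_sub_nf.
exact: wt_sub_nf.
Qed.

(** * The coordinate ring of a chart of the family *)

Section Chart.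
Variable i : 'I_N.
Hypothesis nbU : forall b, nb (b + U_(i))%MM = nb b.

Let A : comNzRingType := {poly K}.
Let chart_ideal := ideal_gen (fun q : {mpoly {poly K}[N]} => Y q \/ q = 'X_i - 1).

Definition drop (b : 'X_{1..N}) := (b - U_(i) *+ b i)%MM.

Lemma dropE b j : drop b j = if j == i then 0%N else b j.
Proof.
rewrite mnmBE mulmnE mnm1E eq_sym; case: eqP => [->|_]; last by rewrite mul0n subn0.
by rewrite mul1n subnn.
Qed.

Lemma dropK b : (drop b + U_(i) *+ b i)%MM = b.
Proof.
apply/mnmP => j; rewrite mnmDE dropE mulmnE mnm1E eq_sym.
by case: eqP => [->|_]; rewrite ?mul1n ?mul0n ?addn0.
Qed.

Lemma nb_drop b : nb (drop b) = nb b.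
Proof.
rewrite -[in RHS](dropK b); elim: (b i) => [|k IHk]; first by rewrite mulm0n addm0.
by rewrite mulmSr addmA nbU.
Qed.

Definition chart_basis : pred 'X_{1..N} := fun b => nb b && (b i == 0%N).

Lemma chart_basis_drop b : nb b -> chart_basis (drop b).
Proof. by rewrite /chart_basis nb_drop dropE eqxx => ->. Qed.

Definition dehomogenize : {mpoly A[N]} -> {mpoly A[N]} :=
  mlin (fun b => 'X_[A, drop b]).

HB.instance Definition _ :=
  GRing.isLinear.Build A {mpoly A[N]} {mpoly A[N]} *:%R dehomogenize (mlin_linear _).

(* Rewriting every monomial into its t-homogenized normal form leaves, after
   setting 'X_i to 1, coordinates in a basis of the coordinate ring of the chart. *)
Definition reduce : {mpoly A[N]} -> {mpoly A[N]} :=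
  mlin (fun b => level (wt (cls b)) (nf b)).

HB.instance Definition _ :=
  GRing.isLinear.Build A {mpoly A[N]} {mpoly A[N]} *:%R reduce (mlin_linear _).

Lemma reduceE (q : {mpoly A[N]}) :
  reduce q = \sum_(b <- msupp q) q@_b *: level (wt (cls b)) (nf b).
Proof. by []. Qed.

Lemma dehomogenizeX b : dehomogenize 'X_[b] = 'X_[A, drop b].
Proof. exact: mlinX. Qed.

Lemma reduceX b : reduce 'X_[b] = level (wt (cls b)) (nf b).
Proof. exact: mlinX. Qed.

Lemma chart_red_subproof (q : {mpoly A[N]}) : dehomogenize (reduce q) \in supported (R := A) chart_basis.
Proof.
apply/supportedP => c nBc; rewrite reduceE (linear_sum dehomogenize) raddf_sum big1 //= => b _.
rewrite (linearZ_LR dehomogenize) mcoeffZ /level (linear_sum dehomogenize) raddf_sum big_seq.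
rewrite big1 ?mulr0 // => d d_nf; rewrite (linearZ_LR dehomogenize) /= dehomogenizeX.
rewrite mcoeffZ mcoeffX; case: eqP; rewrite ?mulr0 // => dc.
by move: nBc; rewrite -dc chart_basis_drop // (nf_normal d_nf).
Qed.

Definition chart_red (q : {mpoly A[N]}) := SuppMod (chart_red_subproof q).

Lemma chart_red_linear : linear chart_red.
Proof. by move=> c q r; apply/val_inj; rewrite /= !linearP. Qed.

HB.instance Definition _ :=
  GRing.isLinear.Build A {mpoly A[N]} (supp_mod A chart_basis) *:%R
    chart_red chart_red_linear.

(** The normal forms of the terms of a relation cancel by independence, and the powers of t add up:
    from k to the weight of b, then on to the weight of c. *)
Lemma reduce_level k f :
    G f -> (forall b, b \in msupp f -> k <= wt (cls b))%N ->
  reduce (level k f) = 0.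
Proof.
move=> Gf le_k; have nf0 : \sum_(b <- msupp f) f@_b *: nf b = 0.
  apply: normal_form_eq0.
    move=> c; apply: contraTT => nnbc; rewrite mcoeff_msupp negbK raddf_sum big1 // => b _.
    by rewrite /= mcoeffZ (memN_msupp_eq0 (contra (@nf_normal b c) nnbc)) mulr0.
  rewrite /ev linear_sum -[RHS]Gf ev_mon; apply: eq_bigr => b _.
  by rewrite linearZ /= -/(ev _) ev_nf.
rewrite {1}/level linear_sum /=.
transitivity (level k (\sum_(b <- msupp f) f@_b *: nf b)); last first.
  by rewrite nf0 /level msupp0 big_nil.
apply/mpolyP => c; rewrite mcoeff_level !raddf_sum scaler_suml !big_seq.
apply: eq_bigr => b bf; rewrite linearZ /= reduceX !mcoeffZ mcoeff_level.
have [/wt_nf[le_bc _]|/memN_msupp_eq0->] := boolP (c \in msupp (nf b)); last first.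
  by rewrite scale0r !mulr0 scale0r.
rewrite -scalerAl -scalerAr scalerA -exprD; congr (_ *: 'X^_).
have := le_k b bf; lia.
Qed.

Lemma levelMX k f c :
  level k f * 'X_[A, c] = level (k + wt (cls c)) (f * 'X_[c]).
Proof.
rewrite /level (perm_big _ (msuppMX f c)) [RHS]big_map mulr_suml; apply: eq_bigr => b _.
by rewrite mcoeffMX clsD wtD [(k + _)%N]addnC subnDl [(c + b)%MM]addmC mpolyXD -scalerAl.
Qed.

Lemma levelB k f g : level k (f - g) = level k f - level k g.
Proof.
by apply/mpolyP => b; rewrite mcoeffB !mcoeff_level mcoeffB scalerBl.
Qed.

Lemma level_cls b : level (wt (cls b)) 'X_[b] = 'X_[A, b].
Proof.
by rewrite /level msuppX big_seq1 mcoeffX eqxx subnn expr0 !scale1r.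
Qed.

Lemma chart_ideal_reduce (q : {mpoly A[N]}) : chart_ideal (q - reduce q).
Proof.
have -> : q - reduce q =
    \sum_(b <- msupp q) q@_b *: level (wt (cls b)) ('X_[b] - nf b).
  rewrite {1}(mpolyE q) reduceE -sumrB; apply: eq_bigr => b _.
  by rewrite levelB level_cls scalerBr.
apply: ideal_gen_sum => b; rewrite level_homogenization; last exact: wt_sub_nf.
rewrite scalerA -mul_mpolyC; apply: ideal_gen_mem; left.
by exists ('X_[b] - nf b) => //; apply: ev_sub_nf.
Qed.

Lemma chart_ideal_dehomogenize (q : {mpoly A[N]}) : chart_ideal (q - dehomogenize q).
Proof.
have -> : q - dehomogenize q =
    \sum_(b <- msupp q) q@_b *: ('X_[A, b] - 'X_[A, drop b]).
  rewrite {1}(mpolyE q) /dehomogenize /mlin -sumrB; apply: eq_bigr => b _.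
  by rewrite scalerBr.
apply: ideal_gen_sum => b; rewrite -mul_mpolyC -[in 'X_[b]](dropK b) mpolyXD -mpolyXn.
rewrite -[X in _ * _ - X]mulr1 -mulrBr subrX1 mulrA; apply: ideal_genM.
by rewrite mulrAC; apply: ideal_gen_mem; right.
Qed.

(** Normality is stable under ['X_i], so both sides come from normal forms of the same value, and
    uniqueness applies. *)
Lemma reduce_mulX (c : 'X_{1..N}) :
  reduce ('X_[c] * 'X_i) = reduce 'X_[c] * 'X_i.
Proof.
rewrite -mpolyXD !reduceX levelMX clsD wtD cls1; congr (level _ _).
apply: normal_form_inj; first exact: nf_normal.
  move=> b; rewrite (perm_mem (msuppMX _ _)) => /mapP[d /nf_normal nbd ->].
  by rewrite addmC nbU.
by rewrite ev_nf /ev rmorphM /= -!/(ev _) ev_nf evX mmap1D.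
Qed.

Lemma dehomogenize_mulX (q : {mpoly A[N]}) : dehomogenize (q * 'X_i) = dehomogenize q.
Proof.
rewrite {1}(mpolyE q) mulr_suml (linear_sum dehomogenize); apply: eq_bigr => b _.
rewrite -scalerAl -mpolyXD (linearZ_LR dehomogenize) /= dehomogenizeX; congr (_ *: 'X_[_]).
apply/mnmP => j; rewrite !dropE; case: eqP => // /eqP ji.
by rewrite mnmDE mnm1E eq_sym (negPf ji) addn0.
Qed.

Lemma flat_chart :
  exists (M : lmodType A) (pi : {linear {mpoly A[N]} -> M}),
    [/\ forall x, exists q : {mpoly A[N]}, pi q = x,
        forall q : {mpoly A[N]}, pi q = 0 <-> chart_ideal q & flat M].
Proof.
exists (supp_mod A chart_basis), chart_red; split; last exact: supp_mod_flat.
  move=> x; exists (supp_val x); apply/val_inj => /=.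
  have Bx b : b \in msupp (supp_val x) -> chart_basis b by apply: (allP (valP x)).
  have -> : reduce (supp_val x) = supp_val x.
    rewrite reduceE [RHS]mpolyE !big_seq; apply: eq_bigr => b /Bx/andP[nbb _].
    by rewrite nf_id // level_cls.
  rewrite {1}(mpolyE (supp_val x)) (linear_sum dehomogenize) [RHS]mpolyE !big_seq.
  apply: eq_bigr => b /Bx/andP[_ /eqP bi0].
  by rewrite (linearZ_LR dehomogenize) /= dehomogenizeX /drop bi0 mulm0n subm0.
move=> q; split=> [/(congr1 val)/= q0|[s sE ->]].
  rewrite -[q](subrK (reduce q)); apply: ideal_genD; first exact: chart_ideal_reduce.
  by rewrite -[reduce q]subr0 -q0; apply: chart_ideal_dehomogenize.
rewrite linear_sum big_seq big1 // => x /sE xE; apply/val_inj => /=.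
(* [chart_red] is only linear, so a generator has to be tested against every monomial factor. *)
rewrite (mpolyE x.1) mulr_suml (linear_sum reduce) (linear_sum dehomogenize).
apply: big1 => c _; rewrite -scalerAl (linearZ_LR reduce) (linearZ_LR dehomogenize).
suff /= -> : dehomogenize (reduce ('X_[c] * x.2)) = 0 by rewrite scaler0.
case: xE => [[f Gf ->]|->]; last first.
  rewrite mulrBr mulr1 (linearB reduce) (linearB dehomogenize) /= reduce_mulX.
  by rewrite dehomogenize_mulX subrr.
rewrite mulrC homogenization_level levelMX reduce_level ?linear0 //.
  by rewrite /G /ev rmorphM /= -!/(ev _) Gf mul0r.
move=> b; rewrite (perm_mem (msuppMX _ _)) => /mapP[d df ->].
by rewrite clsD wtD addnC leq_add2l min_weight_le.
Qed.

End Chart.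

End NormalForms.

(** * Choice of the normal monomials, flatness and general fibres *)

Section Charts.
(* The monomials in std span the algebra generated by p, and phi shows that there
   are at most as many of them as classes in each degree; since the values of the
   normal monomials have distinct leading monomials, they must form a basis. *)
Variables (std : pred 'X_{1..N}) (phi : 'X_{1..N} -> 'X_{1..m}).
Hypothesis std_span : forall b, exists q,
  ev q = mmap1 p b /\ forall c, c \in msupp q -> std c /\ mdeg c = mdeg b.
Hypothesis phi_cls : forall b, std b -> exists2 c, mdeg c = mdeg b & cls c = phi b.
Hypothesis phi_inj : {in std &, injective phi}.

Section NormalMonomials.
Variable i : 'I_N.

(* Preferring large exponents of 'X_i makes multiplication by 'X_i preserve and
   reflect normality, hence normal forms can be dehomogenized. *)
Definition normal b :=
  [forall c : 'X_{1..N < (mdeg b).+1}, (cls c == cls b) ==>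
     ((c i < b i)%N || ((c i == b i) && (val c <= b)%O))].

Lemma normalP b :
  reflect (forall c, cls c = cls b -> (c i <= b i)%N /\ (c i = b i -> (c <= b)%O))
          (normal b).
Proof.
apply: (iffP forallP) => nb_b c.
  move=> eq_cls; have lt_c : (mdeg c < (mdeg b).+1)%N by rewrite (cls_mdeg eq_cls).
  have /implyP := nb_b (BMultinom lt_c); rewrite /= eq_cls eqxx.
  move=> /(_ isT)/orP[lt_cb|/andP[/eqP-> le_cb]]; last by split.
  by split=> [|eq_cb]; [apply: ltnW|rewrite eq_cb ltnn in lt_cb].
apply/implyP => /eqP/nb_b[le_cb le_cb'].
move: le_cb; rewrite leq_eqVlt => /orP[/eqP eq_cb|->] //.
by rewrite eq_cb ltnn eqxx le_cb'.
Qed.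

Lemma normal_inj b c : normal b -> normal c -> cls b = cls c -> b = c.
Proof.
move=> /normalP nb_b /normalP nb_c eq_cls.
have [le_bc le_bc'] := nb_c b eq_cls; have [le_cb le_cb'] := nb_b c (esym eq_cls).
have eq_bci : b i = c i by apply/eqP; rewrite eqn_leq le_bc le_cb.
by apply: le_anti; rewrite le_bc' ?le_cb'.
Qed.

Lemma normal_exists b : exists2 c, normal c & cls c = cls b.
Proof.
pose F := 'X_{1..N < (mdeg b).+1}; pose b0 : F := BMultinom (ltnSn (mdeg b)).
have [c1 /eqP cls_c1 max_c1] := @arg_maxnP F b0 [pred c : F | cls c == cls b]
  (fun c : F => c i) (eqxx _).
have [c2 /andP[/eqP cls_c2 /eqP c2i] max_c2] := @arg_maxP _ _ F c1
  [pred c : F | (cls c == cls b) && (c i == c1 i)] (fun c : F => val c)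
  (introT andP (conj (introT eqP cls_c1) (eqxx _))).
exists (val c2) => //; apply/normalP => c; rewrite cls_c2 => cls_c.
have lt_c : (mdeg c < (mdeg b).+1)%N by rewrite (cls_mdeg cls_c).
rewrite c2i; split; first by apply: (max_c1 (BMultinom lt_c)); rewrite /= cls_c.
by move=> ci; apply: (max_c2 (BMultinom lt_c)); rewrite /= cls_c ci !eqxx.
Qed.

(** Both comparisons are invariant under translation by [U_(i)]. A competitor of [b + U_(i)] without
    ['X_i] already loses by its exponent; any other one can be divided by ['X_i]. *)
Lemma normalU b : normal (b + U_(i))%MM = normal b.
Proof.
apply/normalP/normalP => nb_b c eq_cls.
  have [|le_cb le_cb'] := nb_b (c + U_(i))%MM; first by rewrite !clsD eq_cls.
  move: le_cb le_cb'; rewrite !mnmDE mnm1E eqxx !addn1 ltnS lemc_add2l => le_cb le_cb'.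
  by split=> // eq_cb; apply: le_cb'; rewrite eq_cb.
rewrite mnmDE mnm1E eqxx addn1; have [c0|c_neq0] := eqVneq (c i) 0%N.
  by rewrite c0; split.
have def_c : (c - U_(i) + U_(i))%MM = c by rewrite submK // lep1mP.
have [|le_cb le_cb'] := nb_b (c - U_(i))%MM.
  by apply: (@addIm _ (cls U_(i))); rewrite -!clsD def_c.
move: le_cb le_cb'; rewrite mnmBE mnm1E eqxx => le_cb le_cb'.
split=> [|eq_cb]; first lia.
by rewrite -[c in (c <= _)%O]def_c lemc_add2l le_cb' // eq_cb subn1.
Qed.

(** In the degree of b, normal monomials have independent values, standard ones have spanning
    values, and sending y to the normal monomial of class [phi y] shows that there are at least as
    many of the former. Steinitz exchange concludes. *)
Lemma normal_span b : exists q,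
  ev q = mmap1 p b /\ forall c, c \in msupp q -> normal c /\ mdeg c = mdeg b.
Proof.
pose F := 'X_{1..N < (mdeg b).+1}; pose V := {mpoly K[m]}.
pose B := [set c : F | normal c && (mdeg c == mdeg b)].
pose S := [set c : F | std c && (mdeg c == mdeg b)].
have combE (T : {set F}) (k : F -> K) :
    ev (\sum_(x in T) k x *: 'X_[val x]) = \sum_(x in T) k x *: mmap1 p (val x).
  by rewrite /ev linear_sum; apply: eq_bigr => x _; rewrite linearZ /= -/(ev _) evX.
have combS (T : {set F}) (k : F -> K) c :
    c \in msupp (\sum_(x in T) k x *: 'X_[val x] : {mpoly K[N]}) ->
    exists2 x, x \in T & c = val x.
  case/msupp_sum_le/flatten_mapP => x.
  rewrite mem_filter => /andP[xT _] /msuppZ_le/mem_msuppXP <-; by exists x.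
have span_std c : mdeg c = mdeg b ->
    exists k : F -> K, mmap1 p c = \sum_(y in S) k y *: mmap1 p (val y).
  move=> deg_c; have [q [<- qS]] := std_span c; exists (fun y => q@_(val y)).
  rewrite /ev (@comp_mpolywE _ _ _ _ _ (mdeg b).+1); last first.
    by rewrite msizeE; apply/bigmax_leqP_seq => d /qS[_ ->]; rewrite deg_c.
  rewrite [RHS]big_mkcond; apply: eq_bigr => y _; rewrite inE; case: ifP => [_|nSy].
    by congr (_ *: _); apply: eq_bigr => j _; rewrite tnth_mktuple.
  have [/qS[stdy deg_y]|/memN_msupp_eq0->] := boolP (val y \in msupp q).
    by rewrite stdy deg_y deg_c eqxx in nSy.
  by rewrite scale0r.
have exch := @steinitz_exchange K V F (fun x => mmap1 p (val x)) B S.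
have {exch} spanB : forall y, y \in S ->
    exists k : F -> K, mmap1 p (val y) = \sum_(x in B) k x *: mmap1 p (val x).
  apply: exch.
  - move=> k k0 x xB; have q0 : \sum_(x in B) k x *: 'X_[val x] = 0 :> {mpoly K[N]}.
      apply: (normal_form_eq0 normal_inj); last by rewrite -/ev combE.
      by move=> c /combS[y]; rewrite inE => /andP[ny _] ->.
    have := congr1 (mcoeff (val x)) q0; rewrite mcoeff0 raddf_sum (bigD1 x) //=.
    rewrite mcoeffZ mcoeffX eqxx mulr1 big1 ?addr0 // => y /andP[_ yx].
    by rewrite mcoeffZ mcoeffX (inj_eq val_inj) (negPf yx) mulr0.
  - by move=> x; rewrite inE => /andP[_ /eqP]; apply: span_std.
  have /fin_all_exists[r rP] (y : F) : exists x : F, y \in S ->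
      x \in B /\ cls x = phi y.
    have [yS|_] := boolP (y \in S); last by exists y.
    move: yS; rewrite inE => /andP[stdy /eqP deg_y].
    have [c deg_c cls_c] := phi_cls stdy; have [x nx cls_x] := normal_exists c.
    have deg_x : mdeg x = mdeg b by rewrite (cls_mdeg cls_x) deg_c.
    have lt_x : (mdeg x < (mdeg b).+1)%N by rewrite deg_x.
    by exists (BMultinom lt_x) => _; rewrite inE /= nx deg_x eqxx cls_x.
  rewrite -(@card_in_imset _ _ r S) => [|x y xS yS eq_r].
    by apply/subset_leq_card/subsetP => _ /imsetP[y yS ->]; have [] := rP y yS.
  have [_ cls_x] := rP x xS; have [_ cls_y] := rP y yS; apply: val_inj.
  move: xS yS; rewrite !inE => /andP[xS _] /andP[yS _].
  by apply: phi_inj; rewrite // -cls_x -cls_y eq_r.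
have [k ->] := span_std b erefl.
have /fin_all_exists[C CP] (y : F) : exists c : F -> K, y \in S ->
    mmap1 p (val y) = \sum_(x in B) c x *: mmap1 p (val x).
  have [/spanB[c cP]|_] := boolP (y \in S); last by exists (fun=> 0).
  by exists c.
exists (\sum_(x in B) (\sum_(y in S) k y * C y x) *: 'X_[val x]); split.
  rewrite combE; under eq_bigr => x _ do rewrite scaler_suml.
  rewrite exchange_big; apply: eq_bigr => y yS /=; rewrite (CP y yS) scaler_sumr.
  by apply: eq_bigr => x _; rewrite scalerA.
by move=> c /combS[x]; rewrite inE => /andP[nx /eqP deg_x] ->.
Qed.

End NormalMonomials.

Let G : equations K N := fun f => ev f = 0.
Let Y := groebner_family w G.

Lemma flat_family : flat_subscheme Y.
Proof. by move=> i; apply: flat_chart (@normal_inj i) (@normal_span i) i (@normalU i). Qed.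

(** Scaling coordinate j by [tau ^+ w j] multiplies a monomial of weight v by [tau ^+ v]; this
    cancels the v - k factors t of that monomial and leaves the common unit [tau ^+ k]. *)
Lemma eval_level (A : comNzRingType) (h : {rmorphism {poly K} -> A}) (R : comAlgType A)
    (tau : A) (x : 'rV[R]_N) k f :
    h 'X * tau = 1 -> (forall b, b \in msupp f -> k <= wt (cls b))%N ->
  (map_mpoly (in_alg R) (map_mpoly h (level k f))).@[
     dact (in_alg R \o (fun j => tau ^+ w j)) x 0] =
  in_alg R (tau ^+ k) * (map_mpoly (in_alg R) (map_mpoly (h \o polyC) f)).@[x 0].
Proof.
move=> h_tau le_k; rewrite [in RHS](mpolyE f) /level.
rewrite !map_mpoly_comb !meval_comb mulr_sumr !big_seq /=; apply: eq_bigr => b bf.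
have -> : mmap1 (dact (in_alg R \o (fun j => tau ^+ w j)) x 0) b =
          in_alg R (tau ^+ wt (cls b)) * mmap1 (x 0) b.
  rewrite -(mweight_cls b) /mweight -prodrXr rmorph_prod -big_split /=.
  apply: eq_bigr => j _; rewrite !mxE /= exprMn -[_ ^+ b j](rmorphXn (in_alg R)).
  by rewrite -exprM mulnC.
rewrite !mulrA; congr (_ * _); rewrite -!(rmorphM (in_alg R)); congr (in_alg R _).
rewrite -mul_polyC rmorphM rmorphXn -mulrA [RHS]mulrC; congr (_ * _).
rewrite -[in tau ^+ wt _](subnK (le_k b bf)) exprD mulrA -exprMn h_tau expr1n.
by rewrite mul1r.
Qed.

Lemma general_fibre (L : fieldType) (h : {rmorphism {poly K} -> L}) :
  h 'X != 0 -> isomorphic (base_change h Y) (base_change (h \o polyC) G).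
Proof.
(* Here [tau] is the value of t itself, so [eval_level] is applied to its inverse. *)
move=> tau_neq0; set tau := h 'X in tau_neq0.
have evalE (R : comAlgType L) (x : 'rV[R]_N) f := @eval_level L h R tau^-1 x
  (min_weight w f) f (mulfV tau_neq0) (@min_weight_le f).
apply: (@isomorphic_dact _ _ _ _ (fun j => tau^-1 ^+ w j) (fun j => tau ^+ w j)).
  by move=> j; rewrite -exprMn mulVf // expr1n.
move=> R x; split=> xE q [].
  by move=> _ [f Gf ->] ->; rewrite homogenization_level evalE xE ?mulr0 //; exists f.
move=> f Gf ->; set y := (X in X = 0).
have y0 : in_alg R (tau^-1 ^+ min_weight w f) * y = 0.
  rewrite -evalE -homogenization_level xE //.
  by exists (homogenization w f) => //; exists f.
rewrite -[y]mul1r -(rmorph1 (in_alg R)) -(expr1n _ (min_weight w f)).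
by rewrite -(mulfV tau_neq0) exprMn rmorphM -mulrA y0 mulr0.
Qed.

End Charts.
End Sagbi.

(** * Absorbing the coefficients of the leading terms *)

Section Rescaling.
Variables (K : fieldType) (N m : nat) (a : 'I_N -> 'X_{1..m}).
Implicit Types (d eps : 'I_N -> K) (f : {mpoly K[N]}).

Definition rescale d : {mpoly K[N]} -> {mpoly K[N]} :=
  mlin (fun b => mmap1 d b *: 'X_[b]).

HB.instance Definition _ d :=
  GRing.isLinear.Build K {mpoly K[N]} {mpoly K[N]} *:%R (rescale d) (mlin_linear _).

Lemma eval_rescale (R : comAlgType K) (x : 'rV[R]_N) d f :
  (map_mpoly (in_alg R) (rescale d f)).@[x 0] =
  (map_mpoly (in_alg R) f).@[dact (in_alg R \o d) x 0].
Proof.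
rewrite /rescale /mlin [in RHS](mpolyE f).
under [X in map_mpoly _ X]eq_bigr => b _ do rewrite scalerA.
rewrite !map_mpoly_comb !meval_comb; apply: eq_bigr => b _.
rewrite (rmorphM (in_alg R)) -mulrA; congr (_ * _).
rewrite /mmap1 (rmorph_prod (in_alg R)) -big_split; apply: eq_bigr => j _.
by rewrite !mxE exprMn (rmorphXn (in_alg R)).
Qed.

Lemma initial_ideal_rescale d d' eps f :
    (forall i, d i * d' i = eps i) ->
  initial_ideal a eps f -> initial_ideal a d (rescale d' f).
Proof.
move=> dd' /initial_idealP Jf; apply/initial_idealP => u; rewrite -(Jf u).
rewrite /rescale {1}/mlin /cls_form linear_sum; apply: eq_bigr => b _.
have <- : mmap1 d b * mmap1 d' b = mmap1 eps b.
  by rewrite /mmap1 -big_split; apply: eq_bigr => j _; rewrite /= -exprMn dd'.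
rewrite !linearZ /= mlinX /GRing.scale /= [mmap1 d' b * _]mulrCA [LHS]mulrCA.
by rewrite [mmap1 d b * (_ * _)]mulrCA [mmap1 d b * _]mulrC.
Qed.

Lemma toric_ideal_initial f : toric_ideal a f <-> initial_ideal a (fun=> 1) f.
Proof.
rewrite /toric_ideal /initial_ideal.
suff -> : [tuple 'X_[K, a i] | i < N] = [tuple 1 *: 'X_[K, a i] | i < N] by [].
by apply: eq_from_tnth => i; rewrite !tnth_mktuple scale1r.
Qed.

(** Scaling the coordinates by [eps] absorbs the coefficients, here the signs of the matching terms,
    and leaves the pure monomials of a toric parametrization. *)
Lemma vanishes_toric_ideal eps (R : comAlgType K) (x : 'rV[R]_N) :
    (forall i, eps i != 0) ->
  vanishes (toric_ideal a) x <->
  vanishes (initial_ideal a eps) (dact (in_alg R \o eps) x).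
Proof.
move=> eps_neq0; split=> xE f.
  move=> Jf; rewrite -eval_rescale xE //; apply/toric_ideal_initial.
  by apply: initial_ideal_rescale Jf => i; rewrite mul1r.
move/toric_ideal_initial => Tf.
pose x' := dact (in_alg R \o eps) x.
have -> : x = dact (in_alg R \o (fun i => (eps i)^-1)) x'.
  apply/rowP => j; rewrite !mxE /= mulrA -(rmorphM (in_alg R)) mulVf //.
  by rewrite rmorph1 mul1r.
rewrite -eval_rescale xE //; apply: initial_ideal_rescale Tf => i.
by rewrite mulfV.
Qed.

End Rescaling.

Theorem sagbi_degeneration (K : fieldType) (N m e : nat) (wt : 'X_{1..m} -> nat)
    (p : 'I_N -> {mpoly K[m]}) (a : 'I_N -> 'X_{1..m}) (eps : 'I_N -> K)
    (w : 'I_N -> nat) (std : pred 'X_{1..N}) (phi : 'X_{1..N} -> 'X_{1..m}) :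
    (forall i, w i = wt (a i)) -> (forall u v, wt (u + v)%MM = (wt u + wt v)%N) ->
    (0 < N)%N -> (0 < e)%N -> (forall i, mdeg (a i) = e) ->
    (forall i, eps i != 0) -> (forall i, is_lead wt (p i) (a i) (eps i)) ->
    (forall b, exists q, q \mPo [tuple p i | i < N] = mmap1 p b /\
       forall c, c \in msupp q -> std c /\ mdeg c = mdeg b) ->
    (forall b, std b -> exists2 c, mdeg c = mdeg b & cls a c = phi b) ->
    {in std &, injective phi} ->
  let G := fun f => f \mPo [tuple p i | i < N] = 0 in
  let Y := groebner_family w G in
  toric_degeneration G Y /\ same_subscheme (fibre0 Y) (initial_ideal a eps).
Proof.
move=> wE wtD N_gt0 e_gt0 mdeg_a eps_neq0 lead_p std_span phi_cls phi_inj G Y.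
have Y0 (R : comAlgType K) (x : 'rV[R]_N) :
    vanishes (fibre0 Y) x <-> vanishes (initial_ideal a eps) x.
  (* The normal monomials of any chart describe the fibre over 0. *)
  pose i0 := Ordinal N_gt0.
  exact: (vanishes_fibre0 wE wtD e_gt0 eps_neq0 lead_p
           (@normal_inj _ _ _ _ e_gt0 mdeg_a i0)
           (normal_span wtD e_gt0 mdeg_a eps_neq0 lead_p std_span phi_cls phi_inj i0)).
split; last exact: same_subscheme_vanishes.
split.
- exact: (flat_family wE wtD e_gt0 mdeg_a eps_neq0 lead_p std_span phi_cls phi_inj).
- exists N, m, e, a; split=> //.
  apply: (@isomorphic_dact _ _ _ _ eps (fun i => (eps i)^-1)).
    by move=> i; rewrite mulfV.
  by move=> R x; rewrite Y0; apply: vanishes_toric_ideal.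
- by move=> L h; apply: (general_fibre p wE wtD).
Qed.

(** * The leading terms of the minors *)

Section PermutationWeight.
Variables k n : nat.
Local Notation nP := (nplucker k n).
Implicit Types (i : 'I_nP) (sigma : 'S_k).

Lemma plucker_col_lt i (s s' : 'I_k) :
  (s < s')%N -> (plucker_col i s < plucker_col i s')%N.
Proof.
(* Ordinals are enumerated in increasing order, so the columns form a filtered part of
   [iota 0 n]. *)
have sorted_col : sorted ltn [seq val c | c <- enum (plucker_set i)].
  have -> : [seq val c | c <- enum (plucker_set i)] =
      [seq j <- iota 0 n | j \in [seq val c | c <- enum (plucker_set i)]].
    rewrite -val_enum_ord filter_map; congr map; rewrite {1}/enum_mem -enumT.
    apply: eq_filter => c /=; rewrite mem_map ?mem_enum //; exact: val_inj.
  by apply: sorted_filter; [apply: ltn_trans|apply: iota_ltn_sorted].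
move=> lt_ss'; pose c0 := plucker_col i s.
have nth_col t : val (plucker_col i t) =
    nth 0%N [seq val c | c <- enum (plucker_set i)] t.
  rewrite (nth_map c0) -?cardE ?card_plucker_set //.
  by congr val; apply: enum_val_nth.
rewrite !nth_col; apply: (sorted_ltn_nth ltn_trans) => //;
  by rewrite inE size_map -cardE card_plucker_set.
Qed.

Lemma plucker_col_inj i : injective (plucker_col i).
Proof. by move=> s s' /enum_val_inj/cast_ord_inj. Qed.

Lemma plucker_set_imset i : plucker_set i = [set plucker_col i s | s : 'I_k].
Proof.
apply/eqP; rewrite eq_sym eqEcard card_plucker_set card_imset; last exact: plucker_col_inj.
rewrite card_ord leqnn andbT; apply/subsetP => _ /imsetP[s _ ->]; exact: enum_valP.
Qed.

Lemma card_plucker_setI i (P : pred 'I_n) :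
  #|plucker_set i :&: [set c | P c]| = #|[set s | P (plucker_col i s)]|.
Proof.
rewrite -(card_imset _ (@plucker_col_inj i)); apply: eq_card => c.
rewrite !inE plucker_set_imset; apply/andP/imsetP => [[/imsetP[s _ ->] Pc]|[s]].
  by exists s; rewrite ?inE.
by rewrite inE => Ps ->; split=> //; apply: imset_f.
Qed.

Variable l : nat.
Hypothesis l_le_n : (l <= n)%N.
Local Notation W := (@weight_entry k n l).

(** With rows numbered from 0, row r > 1 falls by r(c' - c) from c to c', row 1 by at most c' - c
    (it rises across l), and row 0 not at all. The lower row thus strictly prefers the later
    column. *)
Lemma weight_entry_exchange (r r' : 'I_k) (c c' : 'I_n) :
    (r' < r)%N -> (c < c')%N -> (1 < r)%N ->
  (W r' c + W r c' < W r c + W r' c')%N.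
Proof.
case: r r' => [[|[|r]] //= lt_r] [[|[|r']] //= lt_r'] lt_rr' lt_cc' _;
  rewrite /weight_entry /=; have := ltn_ord c; have := ltn_ord c'.
- by rewrite !addn0 !add0n => *; rewrite ltn_mul2l /=; lia.
- case: (ltnP c l) => ?; case: (ltnP c' l) => ?; nia.
- move=> *; rewrite !mulnBr; nia.
Qed.

Definition perm_weight i sigma := (\sum_s W (sigma s) (plucker_col i s))%N.

Lemma perm_weight_min_exchange i sigma (s s' : 'I_k) :
    (forall tau, perm_weight i sigma <= perm_weight i tau)%N -> (s < s')%N ->
  (W (sigma s) (plucker_col i s) + W (sigma s') (plucker_col i s') <=
   W (sigma s') (plucker_col i s) + W (sigma s) (plucker_col i s'))%N.
Proof.
move=> /(_ (tperm s s' * sigma)%g) min_sigma /ltn_eqF/negbT.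
rewrite (inj_eq val_inj) => ss'; move: min_sigma.
rewrite /perm_weight (bigD1 s) // (bigD1 s') 1?eq_sym //= addnA.
rewrite [X in (_ <= X)%N](bigD1 s) // (bigD1 s') 1?eq_sym //= [X in (_ <= X)%N]addnA.
rewrite !permM tpermL tpermR [X in (_ <= _ + X)%N](eq_bigr (fun t =>
  W (sigma t) (plucker_col i t))) ?leq_add2r // => t /andP[ts ts'].
by rewrite permM tpermD // eq_sym.
Qed.

End PermutationWeight.

Lemma perm_homo_id k (sigma : 'S_k) :
  {homo sigma : s s' / (s < s')%N} -> sigma = 1%g.
Proof.
have homo_ge (tau : 'S_k) : {homo tau : s s' / (s < s')%N} -> forall s : 'I_k, (s <= tau s)%N.
  move=> homo_tau s; case: s => m /=; elim: m => // m IHm lt_m.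
  have lt_m' := ltnW lt_m; apply: leq_trans (homo_tau (Ordinal lt_m') _ _); last by [].
  exact: IHm.
move=> homo_sigma; apply/permP => s; rewrite perm1; apply/val_inj/eqP.
rewrite eqn_leq homo_ge // andbT -{2}(permK sigma s); apply: homo_ge => t t' lt_tt'.
rewrite ltnNge; apply/negP => le_t't; move: lt_tt'; rewrite ltnNge => /negP; apply.
move: le_t't; rewrite leq_eqVlt => /orP[/eqP/val_inj/perm_inj->//|/homo_sigma].
by rewrite !permKV => /ltnW.
Qed.

Lemma crossing_card k n l (i : 'I_(nplucker k.+2 n)) :
  (#|plucker_set i :&: [set c : 'I_n | (c < l)%N]| == 1%N) =
  (plucker_col i ord0 < l <= plucker_col i (inord 1))%N.
Proof.
set s0 := ord0 : 'I_k.+2; set s1 := inord 1 : 'I_k.+2.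
have s1E : s1 = 1%N :> nat by rewrite inordK.
rewrite (card_plucker_setI i (fun c => c < l)%N); set A := [set s | _].
have colA s : (s \in A) = (plucker_col i s < l)%N by rewrite inE.
have [lt0|ge0] := ltnP (plucker_col i s0) l; last first.
  suff -> : A = set0 by rewrite cards0.
  apply/setP => s; rewrite colA in_set0 ltnNge; apply/negbF/(leq_trans ge0).
  have [->//|s_neq0] := eqVneq s s0; apply/ltnW/plucker_col_lt.
  by rewrite lt0n; apply: contraNneq s_neq0 => s0E; apply/eqP/val_inj.
have [ge1|lt1] := leqP l (plucker_col i s1).
  suff -> : A = [set s0] by rewrite cards1.
  apply/setP => s; rewrite colA in_set1; case: eqVneq => [->//|s_neq0].
  apply/negbTE; rewrite -leqNgt (leq_trans ge1) //.
  have [->//|s_neq1] := eqVneq s s1; apply/ltnW/plucker_col_lt; rewrite s1E.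
  have : val s != 0%N by apply: contraNneq s_neq0 => s0E; apply/eqP/val_inj.
  have : val s != 1%N by apply: contraNneq s_neq1 => s1E'; apply/eqP/val_inj; rewrite /= s1E.
  by move=> /=; case: (nat_of_ord s) => [|[]].
apply/negbTE; rewrite neq_ltn; apply/orP; right.
have <- : #|[set s0; s1]| = 2%N by rewrite cards2 -val_eqE /= s1E.
by apply/subset_leq_card/subsetP => s; rewrite !inE => /orP[]/eqP->.
Qed.

(* An inversion of sigma other than the one between the first two rows could be
   undone for a smaller weight; the order of the first two rows is dictated by
   whether the first two columns lie on both sides of l. *)
Lemma perm_weight_min k n l (l_le_n : (l <= n)%N) (i : 'I_(nplucker k n)) (sigma : 'S_k) :
    (forall tau, perm_weight l i sigma <= perm_weight l i tau)%N ->
  sigma = block_matching l i.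
Proof.
case: k i sigma => [|[|k]] i sigma min_sigma.
- by apply/permP; case.
- by apply/permP => s; rewrite !ord1.
rewrite /block_matching card_plucker_set /= crossing_card.
set s0 := ord0 : 'I_k.+2; set s1 := inord 1 : 'I_k.+2.
have s1E : s1 = 1%N :> nat by rewrite inordK.
have exch (s s' : 'I_k.+2) := @perm_weight_min_exchange _ _ l i sigma s s' min_sigma.
have inv01 (s s' : 'I_k.+2) : (s < s')%N -> (sigma s' < sigma s)%N -> sigma s = s1 /\ sigma s' = s0.
  move=> lt_ss' inv; have := exch s s' lt_ss'.
  have [gt1|le1] := ltnP 1 (sigma s).
    have := weight_entry_exchange l_le_n inv (plucker_col_lt i lt_ss') gt1; lia.
  by split; apply/val_inj; rewrite /= ?s1E; lia.
have [|mono_sigma] := boolP [exists s : 'I_k.+2, exists s' : 'I_k.+2,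
    (s < s')%N && (sigma s' < sigma s)%N].
  case/existsP => s /existsP[s' /andP[lt_ss' inv]].
  have [sE s'E] := inv01 s s' lt_ss' inv.
  (* By [inv01] only the first two rows can be inverted, so exchanging these two values leaves an
     increasing permutation. *)
  have def_sigma : sigma = tperm s0 s1.
    apply: (mulIg (tperm s0 s1)); rewrite tperm2; apply: perm_homo_id => t t' lt_tt'.
    rewrite !permM.
    have tpermE u : val (tperm s0 s1 u) =
        if val u == 0%N then 1%N else if val u == 1%N then 0%N else val u.
      case: tpermP => [->|->|/eqP u0 /eqP u1] /=; rewrite ?s1E //.
      by rewrite -!val_eqE /= s1E in u0 u1; rewrite (negPf u0) (negPf u1).
    rewrite -[X in (X < _)%N]/(val _) -[X in (_ < X)%N]/(val _) !tpermE /=.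
    have [lt_s|/(inv01 _ _ lt_tt')[-> ->]|/val_inj/perm_inj eq_t] :=
      ltngtP (sigma t) (sigma t'); last 2 first.
    - by rewrite /= s1E.
    - by rewrite eq_t ltnn in lt_tt'.
    have not01 : ~ (sigma t = 0%N :> nat /\ sigma t' = 1%N :> nat).
      case=> t0 t'1; have tE : t = s' by apply/(@perm_inj _ sigma)/val_inj; rewrite s'E.
      have t'E : t' = s by apply/(@perm_inj _ sigma)/val_inj; rewrite sE /= s1E.
      by move: lt_tt'; rewrite tE t'E ltnNge ltnW.
    by do ![case: eqP => ?]; try lia; case: not01.
  have s_s0 : s = s0.
    by apply: (@perm_inj _ sigma); rewrite sE def_sigma tpermL.
  have s'_s1 : s' = s1.
    by apply: (@perm_inj _ sigma); rewrite s'E def_sigma tpermR.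
  (* Row 1 decreases inside each block, so a minimal swapped permutation needs the first two columns
     on different sides of l. *)
  have := exch s s' lt_ss'; rewrite sE s'E s_s0 s'_s1 /weight_entry /= s1E /=.
  have := plucker_col_lt i (s := s0) (s' := s1); rewrite s1E => /(_ isT).
  have := ltn_ord (plucker_col i s0); have := ltn_ord (plucker_col i s1).
  case: (ltnP _ l) => lt0; case: (leqP l _) => lt1 //=; lia.
have sigma1 : sigma = 1%g.
  apply: perm_homo_id => t t' lt_tt'; rewrite ltnNge leq_eqVlt.
  apply/negP => /orP[/eqP/val_inj/perm_inj eq_t|inv].
    by rewrite eq_t ltnn in lt_tt'.
  by case/negP: mono_sigma; apply/existsP; exists t; apply/existsP; exists t'; rewrite lt_tt'.
have := exch s0 s1; rewrite sigma1 !perm1 s1E => /(_ isT).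
rewrite /weight_entry /= s1E /=.
have := plucker_col_lt i (s := s0) (s' := s1); rewrite s1E => /(_ isT).
have := ltn_ord (plucker_col i s0); have := ltn_ord (plucker_col i s1).
by case: (ltnP _ l) => lt0; case: (leqP l _) => lt1 //=; lia.
Qed.

Lemma mxvec_index_inj k n (r r' : 'I_k) (c c' : 'I_n) :
  mxvec_index r c = mxvec_index r' c' -> r = r' /\ c = c'.
Proof. by move=> /cast_ord_inj/enum_rank_inj[]. Qed.

Section MinorLeadingTerm.
Variables (K : fieldType) (k n l : nat).
Hypothesis l_le_n : (l <= n)%N.
Implicit Types (i : 'I_(nplucker k n)) (sigma : 'S_k).
Local Notation wt := (@term_weight k n l).

Lemma term_weightD u v : wt (u + v)%MM = (wt u + wt v)%N.
Proof.
rewrite /term_weight -big_split; apply: eq_bigr => r _.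
by rewrite -big_split; apply: eq_bigr => c _; rewrite mnmDE mulnDl.
Qed.

Lemma term_weight1 r c : wt U_(mxvec_index r c)%MM = weight_entry l r c.
Proof.
rewrite /term_weight (bigD1 r) //= (bigD1 c) //= mnm1E eqxx mul1n.
rewrite !big1 ?addn0 // => [r' r'r|c' c'c].
  apply: big1 => c' _; rewrite mnm1E; case: eqP => // /mxvec_index_inj [rr' _].
  by rewrite rr' eqxx in r'r.
rewrite mnm1E; case: eqP => // /mxvec_index_inj [_ cc'].
by rewrite cc' eqxx in c'c.
Qed.

Definition minor_mon i sigma : 'X_{1..k * n} :=
  (\sum_s U_(mxvec_index (sigma s) (plucker_col i s)))%MM.

Lemma term_weight_minor_mon i sigma :
  wt (minor_mon i sigma) = perm_weight l i sigma.
Proof.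
have wt0 : wt 0%MM = 0%N.
  by rewrite /term_weight big1 // => r _; rewrite big1 // => c _; rewrite mnm0E.
rewrite /minor_mon (big_morph _ term_weightD wt0).
by apply: eq_bigr => s _; rewrite term_weight1.
Qed.

Lemma mdeg_minor_mon i sigma : mdeg (minor_mon i sigma) = k.
Proof.
rewrite mdeg_sum (eq_bigr (fun=> 1%N)) => [|s _]; last exact: mdeg1.
by rewrite sum1_card card_ord.
Qed.

Lemma plucker_minorE i :
  plucker_minor K i = \sum_(sigma : 'S_k) (-1) ^+ sigma *: 'X_[minor_mon i sigma].
Proof.
rewrite /plucker_minor -det_tr; apply: eq_bigr => sigma _.
rewrite -[RHS]mul_mpolyC rmorphXn rmorphN1; congr (_ * _).
rewrite /minor_mon -mprodXE; apply: eq_bigr => s _.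
by rewrite !mxE.
Qed.

Lemma perm_weight_lt i sigma :
  sigma != block_matching l i ->
  (perm_weight l i (block_matching l i) < perm_weight l i sigma)%N.
Proof.
have [tau _ min_tau] := @arg_minnP _ (1%g : 'S_k) predT (perm_weight l i) isT.
have <- : tau = block_matching l i by apply: perm_weight_min => // rho; apply: min_tau.
move=> sigma_tau; rewrite ltn_neqAle min_tau // andbT.
apply: contraNneq sigma_tau => eq_wt; apply/eqP.
rewrite (perm_weight_min l_le_n (i := i) (sigma := tau)); last by move=> rho; apply: min_tau.
by apply: perm_weight_min => // rho; rewrite -eq_wt min_tau.
Qed.

Definition lead_mon_minor i := minor_mon i (block_matching l i).
Definition lead_sign i : K := (-1) ^+ block_matching l i.

Lemma is_lead_minor i :
  is_lead wt (plucker_minor K i) (lead_mon_minor i) (lead_sign i).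
Proof.
rewrite /is_lead plucker_minorE (bigD1 (block_matching l i)) //=.
rewrite addrAC subrr add0r; apply: big_ind => [|q r|sigma neq_sigma].
- by move=> v; rewrite msupp0.
- exact: highD.
move=> v /msuppZ_le/mem_msuppXP <-; rewrite /lead_mon_minor.
by rewrite !term_weight_minor_mon !mdeg_minor_mon perm_weight_lt.
Qed.

Lemma matching_termE i :
  matching_term K l i = lead_sign i *: 'X_[lead_mon_minor i].
Proof.
rewrite /matching_term -[RHS]mul_mpolyC rmorphXn rmorphN1; congr (_ * _).
by rewrite /lead_mon_minor /minor_mon -mprodXE.
Qed.

Lemma lead_sign_neq0 i : lead_sign i != 0.
Proof. by rewrite signr_eq0. Qed.

Lemma plucker_weightE i : plucker_weight K k n l i = wt (lead_mon_minor i).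
Proof.
set u := lead_mon_minor i; have lead := @is_lead_minor i.
have u_supp : u \in msupp (plucker_minor K i).
  by rewrite mcoeff_msupp (mcoeff_lead lead) // eqxx mulr1 lead_sign_neq0.
have := seq_minP (map_f wt u_supp); rewrite -/(plucker_weight K k n l i).
case=> /mapP[v v_supp def_min] le_min; apply/eqP; rewrite eqn_leq le_min def_min.
by have [] := high_lead lead v_supp.
Qed.

End MinorLeadingTerm.

(** * Straightening *)

Lemma plucker_col_perm k n (g : 'I_k -> 'I_n) : injective g ->
  exists (i : 'I_(nplucker k n)) (tau : 'S_k), g =1 plucker_col i \o tau.
Proof.
move=> g_inj; pose I := [set g t | t : 'I_k].
have I_k : I \in ksubsets k n by rewrite inE card_imset // card_ord.
pose i : 'I_(nplucker k n) := enum_rank_in I_k I.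
have iE : plucker_set i = I by rewrite /plucker_set enum_rankK_in.
have /fin_all_exists[f fP] t : exists s, g t = plucker_col i s.
  have : g t \in plucker_set i by rewrite iE imset_f.
  by rewrite plucker_set_imset => /imsetP[s _ ->]; exists s.
have f_inj : injective f by move=> t t' ff; apply: g_inj; rewrite !fP ff.
by exists i, (perm f_inj) => t; rewrite /= permE.
Qed.

Section Minors.
Variables (K : fieldType) (k n : nat).
Implicit Types (g h : 'I_k -> 'I_n).

(** Columns form a sequence, possibly unsorted or with repetitions, because exchanges produce such
    sequences. *)
Definition minor g : {mpoly K[k * n]} := \det (\matrix_(r < k, s < k) xvar K r (g s)).

Lemma eq_minor g h : g =1 h -> minor g = minor h.
Proof. by move=> gh; congr (\det _); apply/matrixP => r s; rewrite !mxE gh. Qed.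

Lemma minorE g :
  minor g = \sum_(tau : 'S_k) (-1) ^+ tau * \prod_t xvar K (tau t) (g t).
Proof.
rewrite /minor -det_tr; apply: eq_bigr => tau _; congr (_ * _).
by apply: eq_bigr => t _; rewrite !mxE.
Qed.

Lemma minor_perm g (tau : 'S_k) : minor (g \o tau) = (-1) ^+ tau * minor g.
Proof.
rewrite !minorE mulr_sumr (reindex_inj (mulgI tau)) /=; apply: eq_bigr => rho _.
rewrite odd_permM signr_addb mulrA; congr (_ * _).
rewrite [RHS](reindex_inj (@perm_inj _ tau)); apply: eq_bigr => t _.
by rewrite permM.
Qed.

Lemma minor_noninj g t t' : t != t' -> g t = g t' -> minor g = 0.
Proof.
move=> tt' gtt'; rewrite /minor -det_tr.
by apply: (determinant_alternate tt') => r; rewrite !mxE gtt'.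
Qed.

Lemma minor_plucker g : injective g -> exists (i : 'I_(nplucker k n)) (tau : 'S_k),
  minor g = (-1) ^+ tau * plucker_minor K i /\ g =1 plucker_col i \o tau.
Proof.
case/plucker_col_perm=> i [tau gE]; exists i, tau; split=> //.
by rewrite (eq_minor gE) minor_perm.
Qed.

(** * Garnir relations *)

Section Garnir.
Variables (g h : 'I_k -> 'I_n) (s : 'I_k) (z : 'I_k.+1 -> 'I_n).
Implicit Types sigma : 'S_k.+1.

(** Positions 0 to s of z are the places 0 to s of h; positions s+1 to k are the places s to k-1 of
    g, shifted by one because place s is used in both. *)
Definition shuffle_top sigma (t : 'I_k) : 'I_n :=
  if (t < s)%N then g t else z (sigma (lift ord0 t)).
Definition shuffle_bot sigma (t : 'I_k) : 'I_n :=
  if (t <= s)%N then z (sigma (widen_ord (leqnSn k) t)) else h t.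

Lemma big_lift0 (R : Type) (idx : R) (op : Monoid.law idx) (E : 'I_k.+1 -> R) :
  \big[op/idx]_(q : 'I_k.+1 | (s < q)%N) E q = \big[op/idx]_(t < k | (s <= t)%N) E (lift ord0 t).
Proof.
by rewrite big_mkcond big_ord_recl /= Monoid.mul1m -big_mkcond; apply: eq_bigl.
Qed.

Lemma big_widen (R : Type) (idx : R) (op : Monoid.law idx) (E : 'I_k.+1 -> R) :
  \big[op/idx]_(q : 'I_k.+1 | ~~ (s < q)%N) E q =
  \big[op/idx]_(t < k | (t <= s)%N) E (widen_ord (leqnSn k) t).
Proof.
rewrite big_mkcond big_ord_recr /= ltn_ord Monoid.mulm1 -big_mkcond.
by apply: eq_bigl => t; rewrite -leqNgt.
Qed.

(* The k+1 columns z are permuted over k rows: two of them always meet in the same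
   row, so each term of the Leibniz expansion is a determinant with equal rows.
   Summing over all permutations rather than over shuffles repeats each term, which
   is harmless in characteristic 0. *)
Lemma garnir :
  \sum_(sigma : 'S_k.+1) (-1) ^+ sigma * minor (shuffle_top sigma) * minor (shuffle_bot sigma) = 0.
Proof.
have expand (sigma : 'S_k.+1) : (-1) ^+ sigma * minor (shuffle_top sigma) * minor (shuffle_bot sigma) =
    \sum_(tau : 'S_k) \sum_(tau' : 'S_k) (-1) ^+ sigma *
      (((-1) ^+ tau * \prod_t xvar K (tau t) (shuffle_top sigma t)) *
       ((-1) ^+ tau' * \prod_t xvar K (tau' t) (shuffle_bot sigma t))).
  rewrite !minorE -mulrA mulr_suml mulr_sumr; apply: eq_bigr => tau _.
  by rewrite !mulr_sumr.
under eq_bigr => sigma _ do rewrite expand.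
rewrite exchange_big big1 //= => tau _; rewrite exchange_big big1 //= => tau' _.
(* [rho q] is the row of X which [tau] and [tau'] assign to position q; the default s of [insubd] is
   never reached. *)
pose rho (q : 'I_k.+1) := if (q <= s)%N then tau' (insubd s (val q)) else tau (insubd s q.-1).
pose A := \matrix_(q, q') xvar K (rho q) (z q').
have detA0 : \det A = 0.
  have /injectivePn[q [q' qq' rho_qq']] : ~~ injectiveb rho.
    by apply/negP => /injectiveP/leq_card; rewrite !card_ord ltnn.
  by apply: (determinant_alternate qq') => r; rewrite !mxE rho_qq'.
pose c := (-1) ^+ tau * (-1) ^+ tau' *
  (\prod_(t < k | (t < s)%N) xvar K (tau t) (g t) *
   \prod_(t < k | ~~ (t <= s)%N) xvar K (tau' t) (h t)).
transitivity (c * \det A); last by rewrite detA0 mulr0.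
rewrite /determinant mulr_sumr; apply: eq_bigr => sigma _.
rewrite [X in _ = _ * (_ * X)](bigID (fun q : 'I_k.+1 => (s < q)%N)) /= big_lift0 big_widen.
have -> : \prod_(t < k | (s <= t)%N) A (lift ord0 t) (sigma (lift ord0 t)) =
          \prod_(t < k | (s <= t)%N) xvar K (tau t) (z (sigma (lift ord0 t))).
  apply: eq_bigr => t le_st; rewrite mxE /rho lift0 ltnNge le_st /=; congr (xvar K (tau _) _).
  by apply/val_inj; rewrite insubdK // unfold_in ltn_ord.
have -> : \prod_(t < k | (t <= s)%N) A (widen_ord (leqnSn k) t) (sigma (widen_ord (leqnSn k) t)) =
    \prod_(t < k | (t <= s)%N) xvar K (tau' t) (z (sigma (widen_ord (leqnSn k) t))).
  apply: eq_bigr => t le_ts; rewrite mxE /rho /= le_ts; congr (xvar K (tau' _) _).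
  by apply/val_inj; rewrite insubdK // unfold_in ltn_ord.
rewrite (bigID (fun t : 'I_k => (t < s)%N)) /=.
rewrite [\prod_(t < k) xvar K (tau' t) _](bigID (fun t : 'I_k => (t <= s)%N)) /=.
have -> : \prod_(t < k | (t < s)%N) xvar K (tau t) (shuffle_top sigma t) =
          \prod_(t < k | (t < s)%N) xvar K (tau t) (g t).
  by apply: eq_bigr => t lt_ts; rewrite /shuffle_top lt_ts.
have -> : \prod_(t < k | ~~ (t < s)%N) xvar K (tau t) (shuffle_top sigma t) =
          \prod_(t < k | (s <= t)%N) xvar K (tau t) (z (sigma (lift ord0 t))).
  apply: eq_big => t; first by rewrite -leqNgt.
  by move=> /negPf nlt; rewrite /shuffle_top nlt.
have -> : \prod_(t < k | (t <= s)%N) xvar K (tau' t) (shuffle_bot sigma t) =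
    \prod_(t < k | (t <= s)%N) xvar K (tau' t) (z (sigma (widen_ord (leqnSn k) t))).
  by apply: eq_bigr => t le_ts; rewrite /shuffle_bot le_ts.
have -> : \prod_(t < k | ~~ (t <= s)%N) xvar K (tau' t) (shuffle_bot sigma t) =
          \prod_(t < k | ~~ (t <= s)%N) xvar K (tau' t) (h t).
  by apply: eq_bigr => t /negPf nle; rewrite /shuffle_bot nle.
have shuffle6 (R : comNzRingType) (w x y a b d f : R) :
  w * ((x * (a * b)) * (y * (d * f))) = x * y * (a * f) * (w * (b * d)) by ring.
exact: shuffle6.
Qed.

Hypothesis zg : forall t : 'I_k, (s <= t)%N -> z (lift ord0 t) = g t.
Hypothesis zh : forall t : 'I_k, (t <= s)%N -> z (widen_ord (leqnSn k) t) = h t.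

Lemma sum_shuffle_top sigma :
  (\sum_t shuffle_top sigma t =
   \sum_(t < k | (t < s)%N) g t + \sum_(q : 'I_k.+1 | (s < q)%N) z (sigma q))%N.
Proof.
rewrite (bigID (fun t : 'I_k => (t < s)%N)) /= big_lift0; congr (_ + _)%N.
  by apply: eq_bigr => t lt_ts; rewrite /shuffle_top lt_ts.
apply: eq_big => t; first by rewrite -leqNgt.
by move=> /negPf nlt; rewrite /shuffle_top nlt.
Qed.

Lemma sum_shuffle_bot sigma :
  (\sum_t shuffle_bot sigma t =
   \sum_(q : 'I_k.+1 | ~~ (s < q)) z (sigma q) + \sum_(t < k | ~~ (t <= s)) h t)%N.
Proof.
rewrite (bigID (fun t : 'I_k => (t <= s)%N)) /= big_widen; congr (_ + _)%N.
  by apply: eq_bigr => t le_ts; rewrite /shuffle_bot le_ts.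
by apply: eq_bigr => t /negPf nle; rewrite /shuffle_bot nle.
Qed.

Lemma shuffle_top1 : shuffle_top 1%g =1 g.
Proof.
by move=> t; rewrite /shuffle_top perm1; case: ltnP => // /zg.
Qed.

Lemma shuffle_bot1 : shuffle_bot 1%g =1 h.
Proof.
by move=> t; rewrite /shuffle_bot perm1; case: leqP => // /zh.
Qed.

Lemma sum_shuffle sigma :
  (\sum_t shuffle_top sigma t + \sum_t shuffle_bot sigma t = \sum_t g t + \sum_t h t)%N.
Proof.
have half rho : (\sum_t shuffle_top rho t + \sum_t shuffle_bot rho t =
    \sum_q z q + (\sum_(t < k | (t < s)%N) g t + \sum_(t < k | ~~ (t <= s)) h t))%N.
  have -> : (\sum_q z q = \sum_q z (rho q))%N by apply: reindex_inj; apply: perm_inj.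
  rewrite sum_shuffle_top sum_shuffle_bot.
  rewrite [X in _ = (X + _)%N](bigID (fun q : 'I_k.+1 => (s < q)%N)) /=.
  by rewrite (addnC (\sum_(t < k | (t < s)%N) g t)%N) addnACA.
rewrite half -(half 1%g); congr (_ + _)%N; apply: eq_bigr => t _.
  by rewrite shuffle_top1.
by rewrite shuffle_bot1.
Qed.

Definition block_stable sigma := [forall q : 'I_k.+1, (s < sigma q)%N == (s < q)%N].

Hypothesis z_mono : forall q q' : 'I_k.+1, (q < q')%N -> (z q < z q')%N.

(** As z increases, the top positions hold its largest entries, and an unstable permutation loses
    one of them. *)
Lemma sum_shuffle_top_lt sigma :
  ~~ block_stable sigma -> (\sum_t shuffle_top sigma t < \sum_t g t)%N.
Proof.
move=> nstable; have -> : (\sum_t g t = \sum_t shuffle_top 1%g t)%N.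
  by apply: eq_bigr => t _; rewrite shuffle_top1.
rewrite !sum_shuffle_top ltn_add2l.
under [X in (_ < X)%N]eq_bigr => q _ do rewrite perm1.
pose T' (q : 'I_k.+1) := (s < (sigma^-1)%g q)%N.
have reindexT (F : 'I_k.+1 -> nat) :
    (\sum_(q : 'I_k.+1 | (s < q)%N) F (sigma q) = \sum_(q | T' q) F q)%N.
  rewrite [RHS](reindex_inj (@perm_inj _ sigma)); apply: eq_bigl => q.
  by rewrite /T' permK.
(* The entry at position s separates the two groups; counting c once for each selected position
   makes the comparison termwise. *)
pose c : nat := z (widen_ord (leqnSn k) s).
have le_c (q : 'I_k.+1) : (s < q)%N -> (c < z q)%N by move=> lt_sq; apply: z_mono.
have ge_c (q : 'I_k.+1) : ~~ (s < q)%N -> (z q <= c)%N.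
  rewrite -leqNgt leq_eqVlt => /orP[/eqP eq_qs|]; last by move=> lt_qs; apply/ltnW/z_mono.
  by rewrite /c (_ : q = widen_ord (leqnSn k) s) //; apply/val_inj.
have /= eq_c := reindexT (fun=> c); rewrite (reindexT (fun q => z q)).
suff : (\sum_(q | T' q) z q + \sum_(q : 'I_k.+1 | (s < q)%N) c <
        \sum_(q : 'I_k.+1 | (s < q)%N) z q + \sum_(q | T' q) c)%N by rewrite eq_c ltn_add2r.
rewrite !(big_mkcond T') !(big_mkcond (fun q : 'I_k.+1 => (s < q)%N)) -!big_split /=.
have [q0 Tq0 nTq0] : exists2 q : 'I_k.+1, (s < q)%N & ~~ T' q.
  pose T := [set q : 'I_k.+1 | (s < q)%N].
  have T'E : [set q | T' q] = [set sigma q | q in T].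
    apply/setP => q; rewrite inE -[q in RHS](permKV sigma) mem_imset ?inE //.
    exact: perm_inj.
  have /subsetPn[q] : ~~ (T \subset [set q | T' q]); last by rewrite !inE; exists q.
  apply: contra nstable => sTT'; have eqT : T = [set q | T' q].
    apply/eqP; rewrite eqEcard sTT' /= T'E card_imset ?leqnn //; exact: perm_inj.
  apply/forallP => q; move/setP/(_ (sigma q)): eqT; rewrite !inE /T' permK => ->.
  exact: eqxx.
rewrite (bigD1 q0) //= [X in (_ < X)%N](bigD1 q0) //= (negPf nTq0) Tq0.
rewrite add0n addn0 -addSn leq_add ?le_c //; apply: leq_sum => q _.
case: ifP => _; case: ifP => Tq; rewrite ?addn0 ?add0n //.
  by apply: ge_c; rewrite Tq.
exact/ltnW/le_c.
Qed.

(** A stable permutation is a product of one acting on the places of g and one acting on those of h;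
    each sign occurs once in [sigma] and once in a minor. *)
Lemma block_stable_minor sigma : block_stable sigma ->
  (-1) ^+ sigma * minor (shuffle_top sigma) * minor (shuffle_bot sigma) =
  minor g * minor h.
Proof.
move=> /forallP stable; have stableE (q : 'I_k.+1) : (s < sigma q)%N = (s < q)%N.
  by have /eqP := stable q.
pose f1 (t : 'I_k) := if (t < s)%N then t else insubd s (sigma (lift ord0 t)).-1.
have f1E t : lift ord0 (f1 t) = if (t < s)%N then lift ord0 t else sigma (lift ord0 t).
  rewrite /f1; case: ltnP => // le_st; apply/val_inj; rewrite [LHS]lift0.
  have := stableE (lift ord0 t); rewrite lift0 ltnS le_st => gt_s.
  have := ltn_ord (sigma (lift ord0 t)) => lt_k.
  rewrite insubdK; first by rewrite prednK //; lia.
  by rewrite unfold_in; lia.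
have f1_inj : injective f1.
  move=> t t' /(congr1 (lift ord0)); rewrite !f1E.
  case: ltnP => lt_t; case: ltnP => lt_t'; try by [move/lift_inj|move/perm_inj/lift_inj].
    move=> eq_t; have := stableE (lift ord0 t'); rewrite -eq_t !lift0 !ltnS.
    by rewrite lt_t' leqNgt lt_t.
  move=> eq_t; have := stableE (lift ord0 t); rewrite eq_t !lift0 !ltnS.
  by rewrite lt_t leqNgt lt_t'.
pose wid := widen_ord (leqnSn k).
have wid_inj : injective wid by move=> t t' /(congr1 val)/= /val_inj.
pose f2 (t : 'I_k) := if (t <= s)%N then insubd s (val (sigma (wid t))) else t.
have f2E t : wid (f2 t) = if (t <= s)%N then sigma (wid t) else wid t.
  rewrite /f2; case: leqP => // le_ts; apply/val_inj; rewrite /= insubdK // unfold_in.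
  have : (sigma (wid t) <= s)%N by rewrite leqNgt stableE -leqNgt.
  by move=> /leq_ltn_trans; apply.
have f2_inj : injective f2.
  move=> t t' /(congr1 wid); rewrite !f2E.
  case: leqP => lt_t; case: leqP => lt_t'; try by [move/wid_inj|move/perm_inj/wid_inj].
    move=> eq_t; have := stableE (wid t); rewrite eq_t /= lt_t'.
    by rewrite ltnNge lt_t.
  move=> eq_t; have := stableE (wid t'); rewrite -eq_t /= lt_t.
  by rewrite ltnNge lt_t'.
have topE : shuffle_top sigma =1 g \o perm f1_inj.
  move=> t; rewrite /shuffle_top /= permE; case: ltnP => [lt_ts|le_st].
    by congr g; rewrite /f1 lt_ts.
  have le_s : (s <= f1 t)%N.
    by rewrite -ltnS -[(f1 t).+1]lift0 f1E [(t < s)%N]ltnNge le_st /= stableE lift0 ltnS.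
  by rewrite -zg // f1E [(t < s)%N]ltnNge le_st.
have botE : shuffle_bot sigma =1 h \o perm f2_inj.
  move=> t; rewrite /shuffle_bot /= permE; case: leqP => [le_ts|lt_st].
    have le_s : (f2 t <= s)%N.
      rewrite -[X in (X <= _)%N]/(val (wid (f2 t))) f2E le_ts leqNgt stableE.
      by rewrite -leqNgt.
    by rewrite -zh // -/wid f2E le_ts.
  by congr h; rewrite /f2 leqNgt lt_st.
have sigmaE : sigma = (lift_perm ord0 ord0 (perm f1_inj) *
                       lift_perm ord_max ord_max (perm f2_inj))%g.
  have lift_maxE t : lift ord_max t = wid t by apply/val_inj; rewrite [LHS]lift_max.
  have fix2 (q : 'I_k.+1) : (s < q)%N -> lift_perm ord_max ord_max (perm f2_inj) q = q.
    case: (unliftP ord_max q) => [t ->|-> _]; last by rewrite lift_perm_id.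
    by rewrite lift_perm_lift (permE f2_inj) !lift_maxE f2E /= ltnNge => /negPf->.
  apply/permP => q; rewrite permM; have [lt_sq|le_qs] := ltnP s q.
    case: (unliftP ord0 q) lt_sq => [t ->|->] //.
    rewrite lift0 ltnS => le_st; rewrite lift_perm_lift (permE f1_inj) f1E [(t < s)%N]ltnNge le_st /=.
    by rewrite fix2 // stableE lift0 ltnS.
  have -> : lift_perm ord0 ord0 (perm f1_inj) q = q.
    case: (unliftP ord0 q) le_qs => [t ->|->]; last by rewrite lift_perm_id.
    by rewrite lift0 => lt_ts; rewrite lift_perm_lift (permE f1_inj) f1E lt_ts.
  case: (unliftP ord_max q) le_qs => [t ->|->]; last first.
    by rewrite leqNgt ltn_ord.
  by rewrite lift_maxE /= => le_ts; rewrite -lift_maxE lift_perm_lift (permE f2_inj) !lift_maxE f2E le_ts.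
rewrite (eq_minor topE) (eq_minor botE) !minor_perm.
have -> : (-1) ^+ sigma = (-1) ^+ perm f1_inj * (-1) ^+ perm f2_inj :> {mpoly K[k * n]}.
  by rewrite {1}sigmaE odd_permM !odd_lift_perm /= !addbb -signr_addb.
rewrite -!mulrA; have signK (b : bool) : (-1) ^+ b * (-1) ^+ b = 1 :> {mpoly K[k * n]}.
  by rewrite -signr_addb addbb.
have rearr (R : comNzRingType) (x y u v : R) :
  x * (y * (x * (u * (y * v)))) = (x * x) * (y * y) * (u * v) by ring.
by rewrite rearr !signK !mul1r.
Qed.

End Garnir.
End Minors.

Section Straightening.
Variables (K : fieldType) (k n : nat).
Hypothesis charK : [pchar K] =i pred0.
Local Notation nP := (nplucker k n).
Implicit Types (i j : 'I_nP) (b c : 'X_{1..nP}).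
Local Notation p := (@plucker_minor K k n).

Definition col_sum i : nat := (\sum_t plucker_col i t)%N.

(** The Garnir relation solved for its stable terms. The descent at s joins h_0 < ... < h_s to g_s <
    ... into one increasing sequence z, so every other nonzero term lowers the first sum. *)
Lemma plucker_exchange i j (s : 'I_k) :
    (plucker_col j s < plucker_col i s)%N ->
  exists (c : 'S_k.+1 -> K) (f : 'S_k.+1 -> 'I_nP * 'I_nP),
    p i * p j = \sum_sigma c sigma *: (p (f sigma).1 * p (f sigma).2) /\
    forall sigma, c sigma != 0 -> (col_sum (f sigma).1 < col_sum i)%N /\
      (col_sum (f sigma).1 + col_sum (f sigma).2 = col_sum i + col_sum j)%N.
Proof.
move=> lt_ji; pose g := plucker_col i; pose h := plucker_col j.
pose z (q : 'I_k.+1) := if (q <= s)%N then h (insubd s (q : nat)) else g (insubd s q.-1).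
have zg (t : 'I_k) : (s <= t)%N -> z (lift ord0 t) = g t.
  move=> le_st; rewrite /z lift0 ltnNge le_st /=; congr g.
  by apply/val_inj; rewrite insubdK // unfold_in ltn_ord.
have zh (t : 'I_k) : (t <= s)%N -> z (widen_ord (leqnSn k) t) = h t.
  move=> le_ts; rewrite /z /= le_ts; congr h.
  by apply/val_inj; rewrite insubdK // unfold_in ltn_ord.
have g_mono (t t' : 'I_k) : (t <= t')%N -> (g t <= g t')%N.
  by rewrite leq_eqVlt => /orP[/eqP/val_inj->//|/(plucker_col_lt i)/ltnW].
have h_mono (t t' : 'I_k) : (t <= t')%N -> (h t <= h t')%N.
  by rewrite leq_eqVlt => /orP[/eqP/val_inj->//|/(plucker_col_lt j)/ltnW].
have val_insubd (m : nat) : (m < k)%N -> insubd s m = m :> nat.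
  by move=> lt_mk; rewrite -[LHS]/(val _) insubdK // unfold_in.
have z_mono (q q' : 'I_k.+1) : (q < q')%N -> (z q < z q')%N.
  move=> lt_qq'; rewrite /z; have := ltn_ord s; have := ltn_ord q' => lt_q' lt_s.
  case: (leqP q s) => q_s; case: (leqP q' s) => q'_s.
  - by apply: plucker_col_lt; rewrite !val_insubd; lia.
  - have le_h : (h (insubd s (q : nat)) <= h s)%N by apply: h_mono; rewrite val_insubd; lia.
    have le_g : (g s <= g (insubd s q'.-1))%N by apply: g_mono; rewrite val_insubd; lia.
    exact: leq_ltn_trans le_h (leq_trans lt_ji le_g).
  - lia.
  - by apply: plucker_col_lt; rewrite !val_insubd; lia.
pose P sigma := block_stable s sigma.
pose term (sigma : 'S_k.+1) : {mpoly K[k * n]} :=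
  (-1) ^+ sigma * minor K (shuffle_top g s z sigma) * minor K (shuffle_bot h s z sigma).
pose M : nat := #|[pred sigma | P sigma]|.
have M_neq0 : M%:R != 0 :> K.
  rewrite (proj1 (pcharf0P K) charK) -lt0n; apply/card_gt0P; exists 1%g.
  by apply/forallP => q; rewrite perm1.
have garnir_eq : M%:R *: (p i * p j) + \sum_(sigma | ~~ P sigma) term sigma = 0.
  rewrite -[RHS](garnir K g h s z) [RHS](bigID P) /=; congr (_ + _).
  rewrite scaler_nat -sumr_const; apply: eq_bigr => sigma.
  by rewrite inE => stable; rewrite block_stable_minor.
have /fin_all_exists[y yP] (sigma : 'S_k.+1) : exists y : K * ('I_nP * 'I_nP),
    ~~ P sigma -> term sigma = y.1 *: (p y.2.1 * p y.2.2) /\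
    (y.1 != 0 -> (col_sum y.2.1 < col_sum i)%N /\
      (col_sum y.2.1 + col_sum y.2.2 = col_sum i + col_sum j)%N).
  have [/injectiveP top_inj|/injectivePn[t [t' tt' eq_t]]] :=
    boolP (injectiveb (shuffle_top g s z sigma)); last first.
    (* A repeated column makes the minor vanish; the coefficient 0 exempts this dummy pair from the
       conditions on sums. *)
    exists (0, (i, j)) => _; rewrite scale0r eqxx; split=> //.
    by rewrite /term (minor_noninj K tt' eq_t) mulr0 mul0r.
  have [/injectiveP bot_inj|/injectivePn[t [t' tt' eq_t]]] :=
    boolP (injectiveb (shuffle_bot h s z sigma)); last first.
    exists (0, (i, j)) => _; rewrite scale0r eqxx; split=> //.
    by rewrite /term (minor_noninj K tt' eq_t) mulr0.
  have [i' [tau [top_eq topE]]] := minor_plucker K top_inj.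
  have [j' [tau' [bot_eq botE]]] := minor_plucker K bot_inj.
  exists ((-1) ^+ sigma * (-1) ^+ tau * (-1) ^+ tau', (i', j')) => nstable /=.
  have sum_i' : col_sum i' = (\sum_t shuffle_top g s z sigma t)%N.
    rewrite /col_sum (reindex_inj (@perm_inj _ tau)); apply: eq_bigr => t _.
    by rewrite topE.
  have sum_j' : col_sum j' = (\sum_t shuffle_bot h s z sigma t)%N.
    rewrite /col_sum (reindex_inj (@perm_inj _ tau')); apply: eq_bigr => t _.
    by rewrite botE.
  split=> [|_]; last first.
    by rewrite sum_i' sum_j' (sum_shuffle zg zh) (sum_shuffle_top_lt zg z_mono).
  rewrite /term top_eq bot_eq -mul_mpolyC !rmorphM !rmorph_sign.
  have rearr (R : comNzRingType) (a b c u v : R) :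
    a * (b * u) * (c * v) = a * b * c * (u * v) by ring.
  exact: rearr.
exists (fun sigma => if P sigma then 0 else - (M%:R)^-1 * (y sigma).1), (fun sigma => (y sigma).2).
split=> [|sigma]; last first.
  case: ifP => [_|/negbT/yP[_ y_cond]]; first by rewrite eqxx.
  by rewrite mulf_eq0 negb_or => /andP[_ /y_cond].
apply: (scalerI M_neq0); move/eqP: garnir_eq; rewrite addr_eq0 => /eqP->.
rewrite scaler_sumr -sumrN big_mkcond; apply: eq_bigr => sigma _ /=.
case: ifPn => [nP|]; last by rewrite negbK => ->; rewrite scale0r scaler0.
have [-> _] := yP sigma nP; rewrite (negPf nP) !scalerA mulrA mulrN mulfV //.
by rewrite mulN1r scaleNr.
Qed.

Definition col_le i j := [forall t, (plucker_col i t <= plucker_col j t)%N].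

(** The sets occurring in b form a chain, so as columns they can be arranged into a semistandard
    tableau. *)
Definition standard : pred 'X_{1..nP} := fun b =>
  [forall i, forall j, (0 < b i)%N && (0 < b j)%N ==> col_le i j || col_le j i].

Local Notation ev q := (q \mPo [tuple p i | i < nP]).

Definition std_comb (d : nat) (x : {mpoly K[k * n]}) :=
  exists q : {mpoly K[nP]}, ev q = x /\
    forall c, c \in msupp q -> standard c /\ mdeg c = d.

Lemma std_comb0 d : std_comb d 0.
Proof. by exists 0; split=> [|c]; rewrite ?linear0 // msupp0. Qed.

Lemma std_combD d x y : std_comb d x -> std_comb d y -> std_comb d (x + y).
Proof.
case=> q [<- qd] [r [<- rd]]; exists (q + r); rewrite linearD; split=> // c.
by move=> /msuppD_le; rewrite mem_cat => /orP[/qd|/rd].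
Qed.

Lemma std_combZ d a x : std_comb d x -> std_comb d (a *: x).
Proof.
by case=> q [<- qd]; exists (a *: q); rewrite linearZ; split=> // c /msuppZ_le/qd.
Qed.

(* Exchanging columns from the set with the smaller sum of columns to the other one
   pulls the two sums apart, which increases the sum of their squares. *)
Definition energy b : nat := (\sum_i b i * col_sum i ^ 2)%N.

Lemma energyD b c : energy (b + c)%MM = (energy b + energy c)%N.
Proof.
by rewrite -big_split; apply: eq_bigr => i _; rewrite mnmDE mulnDl.
Qed.

Lemma energy1 i : energy U_(i)%MM = (col_sum i ^ 2)%N.
Proof.
rewrite /energy (bigD1 i) //= mnm1E eqxx mul1n big1 ?addn0 // => j ji.
by rewrite mnm1E eq_sym (negPf ji).
Qed.

Lemma energy_le b : (energy b <= mdeg b * (k * n) ^ 2)%N.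
Proof.
rewrite mdegE big_distrl; apply: leq_sum => i _; rewrite leq_mul2l leq_exp2r //.
rewrite orbC; apply/orP; left; rewrite -[k in (k * n)%N]card_ord -sum_nat_const.
by apply: leq_sum => t _; apply: ltnW.
Qed.

(** Of two incomparable sets, i is the one with the smaller sum: the exchange lowers its sum and so
    pulls the two sums apart. *)
Lemma not_standardP b : ~~ standard b -> exists i j c (s : 'I_k),
  [/\ b = (c + U_(i) + U_(j))%MM, (plucker_col j s < plucker_col i s)%N &
      (col_sum i <= col_sum j)%N].
Proof.
case/forallPn => i /forallPn[j]; rewrite negb_imply negb_or.
case/andP => /andP[bi bj] /andP[].
wlog le_ij : i j bi bj / (col_sum i <= col_sum j)%N => [wl|].
  have [|/ltnW] := leqP (col_sum i) (col_sum j); first exact: wl.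
  by move=> le_ji nle_ij nle_ji; apply: (wl j i).
case/forallPn => s; rewrite -ltnNge => lt_s /forallPn[s' nle].
have ij : i != j by apply: contraNneq nle => ->.
exists i, j, (b - U_(j) - U_(i))%MM, s; split=> //.
rewrite submK; first by rewrite submK // lep1mP -lt0n.
by rewrite lep1mP mnmBE mnm1E [j == i]eq_sym (negPf ij) subn0 -lt0n.
Qed.

Lemma straightening b : std_comb (mdeg b) (mmap1 p b).
Proof.
have [m] := ubnP (mdeg b * (k * n) ^ 2 - energy b)%N; elim: m b => // m IHm b lt_m.
have [std_b|/not_standardP[i [j [c [s [def_b lt_s le_sum]]]]]] := boolP (standard b).
  exists 'X_[b]; split=> [|d /mem_msuppXP <- //].
  by rewrite comp_mpolyX; apply: eq_bigr => i _; rewrite tnth_mktuple.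
have [a [f [exch fP]]] := plucker_exchange lt_s.
have -> : mmap1 p b = \sum_sigma a sigma *:
    mmap1 p (c + U_((f sigma).1) + U_((f sigma).2))%MM.
  rewrite def_b !mmap1D !mmap1U -mulrA exch mulr_sumr; apply: eq_bigr => sigma _.
  by rewrite -scalerAr !mmap1D !mmap1U mulrA.
apply: big_ind => [||sigma _]; [exact: std_comb0|exact: std_combD|].
have [->|/fP[lt_sum eq_sum]] := eqVneq (a sigma) 0.
  by rewrite scale0r; apply: std_comb0.
apply: std_combZ; set b' := (_ + _)%MM.
have deg_b' : mdeg b' = mdeg b by rewrite def_b !mdegD !mdeg1.
rewrite -deg_b'; apply: IHm; rewrite deg_b'.
have := energy_le b'; rewrite deg_b'.
suff : (energy b < energy b')%N by lia.
rewrite def_b !energyD !energy1 -!addnA ltn_add2l; nia.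
Qed.

End Straightening.

(** * From standard monomials to row contents of matching field tableaux *)

(* Bracket matching on multisets: A t clients are served at time t by the tokens
   B i with i < t, as long as there are any left. If all tokens end up being used,
   running time backwards recovers A and B from the numbers of served clients and
   from A + B. *)
Section Queue.
Variables (A B : nat -> nat).

Fixpoint queue (t : nat) : nat :=
  if t is t'.+1 then (queue t' - minn (A t') (queue t') + B t')%N else 0%N.

Definition served (t : nat) : nat := minn (A t) (queue t).

Lemma queueS t : queue t.+1 = (queue t - served t + B t)%N.
Proof. by []. Qed.

Lemma served_le t : (served t <= A t)%N. Proof. exact: geq_minl. Qed.

Lemma served_le_queue t : (served t <= queue t)%N. Proof. exact: geq_minr. Qed.

Lemma queue_balance t : (queue t + \sum_(0 <= i < t) served i = \sum_(0 <= i < t) B i)%N.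
Proof.
elim: t => [|t IHt]; first by rewrite !big_geq.
by rewrite queueS !big_nat_recr //=; have := served_le_queue t; lia.
Qed.

Lemma sum_served_lt t : (\sum_(0 <= i < t.+1) served i <= \sum_(0 <= i < t) B i)%N.
Proof.
by rewrite -queue_balance big_nat_recr //= addnC leq_add2r served_le_queue.
Qed.

Variable T : nat.
Hypothesis dom : forall t, (t < T)%N ->
  (\sum_(t <= i < T) B i <= \sum_(t.+1 <= i < T) A i)%N.

(** The clients still to come can absorb all waiting and future tokens. If all clients at t are
    served, both sides lose [A t]; otherwise the queue is exhausted and [dom] restarts the bound. *)
Lemma queue_empties : queue T = 0%N.
Proof.
suff inv t : (t <= T)%N -> (queue t + \sum_(t <= i < T) B i <= \sum_(t <= i < T) A i)%N.
  by have := inv T (leqnn T); rewrite !big_geq // addn0 leqn0 => /eqP.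
elim: t => [_|t IHt lt_tT].
  have [->|T_gt0] := posnP T; first by rewrite !big_geq.
  apply: leq_trans (dom T_gt0) _; rewrite [X in (_ <= X)%N]big_ltn //.
  exact: leq_addl.
have := IHt (ltnW lt_tT); have := dom lt_tT; rewrite queueS /served.
rewrite [X in (X <= _)%N -> _]big_ltn // [X in _ -> (_ + X <= _)%N -> _]big_ltn //.
rewrite [X in _ -> (_ <= X)%N -> _]big_ltn //; case: (leqP (A t) (queue t)); lia.
Qed.

Lemma sum_served : (\sum_(0 <= i < T) served i = \sum_(0 <= i < T) B i)%N.
Proof. by rewrite -queue_balance queue_empties. Qed.

Lemma queue_inverse t : B t = minn (A t + B t - served t) (queue t.+1).
Proof.
rewrite queueS /served; lia.
Qed.

End Queue.

Lemma queue_inj (A B A' B' : nat -> nat) (T : nat) :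
    queue A B T = queue A' B' T ->
    (forall t, (t < T)%N -> served A B t = served A' B' t) ->
    (forall t, (t < T)%N -> A t + B t = A' t + B' t)%N ->
  forall t, (t < T)%N -> A t = A' t /\ B t = B' t.
Proof.
elim: T => // T IHT eqT eq_served eq_sum.
have eqB : B T = B' T.
  by rewrite (queue_inverse A B) (queue_inverse A' B') eqT eq_served // eq_sum.
have eqA : A T = A' T by apply: (@addIn (B T)); rewrite eq_sum // eqB.
have eq_queue : queue A B T = queue A' B' T.
  move: eqT (eq_served T (leqnn _)) (served_le_queue A B T) (served_le_queue A' B' T).
  by rewrite !queueS eqB; lia.
move=> t; rewrite ltnS leq_eqVlt => /orP[/eqP->//|lt_tT].
by apply: (IHT eq_queue) => // i lt_iT; [apply: eq_served|apply: eq_sum]; apply: ltnW.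
Qed.

Definition multilist (F psi : nat -> nat) (T : nat) : seq nat :=
  flatten [seq nseq (F t) (psi t) | t <- index_iota 0 T].

Lemma count_multilist F psi T (P : pred nat) :
  count P (multilist F psi T) = (\sum_(0 <= t < T) P (psi t) * F t)%N.
Proof.
rewrite count_flatten -map_comp sumnE big_map; apply: eq_bigr => t _ /=.
exact: count_nseq.
Qed.

Lemma size_multilist F psi T : size (multilist F psi T) = (\sum_(0 <= t < T) F t)%N.
Proof.
by rewrite -count_predT count_multilist; apply: eq_bigr => t _; rewrite mul1n.
Qed.

(** Both lists are sorted and paired in order: the domination at the least y yields some x below it,
    hence the least x is below it. *)
Lemma increasing_pairing (X Y : seq nat) :
    size X = size Y ->
    (forall v, count (fun y => y <= v) Y <= count (fun x => x < v) X)%N ->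
  exists zs : seq (nat * nat), [/\ perm_eq (unzip1 zs) X, perm_eq (unzip2 zs) Y &
    all (fun z => z.1 < z.2)%N zs].
Proof.
move=> eq_size dom; exists (zip (sort leq X) (sort leq Y)).
have eq_size' : size (sort leq X) = size (sort leq Y) by rewrite !size_sort.
rewrite unzip1_zip ?eq_size' // unzip2_zip ?eq_size' // !perm_sort !perm_refl; split=> //.
have {}dom v : (count (fun y => y <= v) (sort leq Y) <= count (fun x => x < v) (sort leq X))%N.
  by rewrite !count_sort.
elim: (sort leq X) (sort leq Y) (sort_sorted leq_total X) (sort_sorted leq_total Y)
  eq_size' dom => [|x X' IHX] [|y Y'] //= sX sY [eq_size'] dom.
have lt_xy : (x < y)%N.
  rewrite ltnNge; apply/negP => le_yx; have := dom y.
  rewrite leqnn ltnNge le_yx /= (_ : count (fun x => x < y)%N X' = 0%N) //.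
  apply/eqP; rewrite -leqn0 leqNgt -has_count; apply/hasPn => x' x'X.
  by rewrite -leqNgt (leq_trans le_yx) // (allP (order_path_min leq_trans sX)).
rewrite lt_xy; apply: IHX => //; [exact: path_sorted sX|exact: path_sorted sY|move=> v].
have [lt_vy|le_yv] := ltnP v y.
  rewrite (_ : count (fun y => y <= v)%N Y' = 0%N) //.
  apply/eqP; rewrite -leqn0 leqNgt -has_count; apply/hasPn => y' y'Y.
  by rewrite -ltnNge (leq_trans lt_vy) // (allP (order_path_min leq_trans sY)).
by have := dom v; rewrite le_yv (leq_trans lt_xy le_yv) leq_add2l.
Qed.

Lemma perm_map_align (S W : eqType) (f : S -> W) (s : seq S) (t : seq W) :
  perm_eq (map f s) t -> exists2 s', perm_eq s' s & map f s' = t.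
Proof.
elim: t s => [|y t IHt] s perm_st.
  by exists [::] => //; move/perm_size: perm_st; rewrite size_map; case: s.
have /mapP[x xs def_y] : y \in map f s by rewrite (perm_mem perm_st) mem_head.
have perm_s := perm_to_rem xs.
have [s' perm_s' def_t] : exists2 s', perm_eq s' (rem x s) & map f s' = t.
  apply: IHt; rewrite -(perm_cons y) -(permPr perm_st) perm_sym.
  by rewrite (permPl (perm_map f perm_s)) /= -def_y.
exists (x :: s'); last by rewrite /= def_t def_y.
by rewrite perm_sym (permPl perm_s) perm_cons perm_sym.
Qed.

Lemma sum_pred1_nat (a T y : nat) :
  (\sum_(a <= i < T) (i == y) = (a <= y < T))%N.
Proof.
transitivity (\sum_(a <= i < T | i == y) 1)%N.
  by rewrite [RHS]big_mkcond; apply: eq_bigr => i _; case: eqP.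
by rewrite sum1_count count_uniq_mem ?iota_uniq // mem_index_iota.
Qed.

Lemma increasing_plucker_col k n (g : 'I_k -> 'I_n) :
  (forall t t' : 'I_k, t < t' -> g t < g t')%N ->
  exists i : 'I_(nplucker k n), plucker_col i =1 g.
Proof.
move=> g_mono; have g_inj : injective g.
  move=> t t' eq_g; apply/val_inj; case: (ltngtP t t') => // /g_mono;
  by rewrite eq_g ltnn.
have [i [tau gE]] := plucker_col_perm g_inj.
exists i => t; rewrite gE /= (_ : tau = 1%g) ?perm1 //.
apply: perm_homo_id => s s' lt_ss'; rewrite ltnNge; apply/negP => le_tau.
have := g_mono _ _ lt_ss'; rewrite !gE /= ltnNge => /negP; apply.
move: le_tau; rewrite leq_eqVlt => /orP[/eqP/val_inj->//|].
by move=> /(plucker_col_lt i)/ltnW.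
Qed.

Lemma plucker_col_ext k n (i j : 'I_(nplucker k n)) :
  plucker_col i =1 plucker_col j -> i = j.
Proof.
move=> eq_col; apply: enum_val_inj; rewrite -!/(plucker_set _) !plucker_set_imset.
exact: eq_imset.
Qed.

Section RowContents.
Variables (k n : nat).
Local Notation nP := (nplucker k n).
Implicit Types (b c : 'X_{1..nP}) (i j : 'I_nP).

(** v ranges over all of [nat] so that the reflected and shifted positions of the bracket matching
    need no bounds. *)
Definition row_content b (r : 'I_k) (v : nat) : nat :=
  (\sum_i b i * (plucker_col i r == v :> nat))%N.

Lemma row_contentD b c r v :
  row_content (b + c)%MM r v = (row_content b r v + row_content c r v)%N.
Proof.
by rewrite -big_split; apply: eq_bigr => i _; rewrite mnmDE mulnDl.
Qed.

Lemma row_content_out b r v : (n <= v)%N -> row_content b r v = 0%N.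
Proof.
move=> le_nv; rewrite /row_content big1 // => i _.
by rewrite ltn_eqF ?muln0 // (leq_trans (ltn_ord _)).
Qed.

Lemma row_content_gt0 b r v :
  (0 < row_content b r v)%N = [exists i, (0 < b i)%N && (plucker_col i r == v :> nat)].
Proof.
apply/idP/existsP => [|[i /andP[bi eq_v]]].
  rewrite lt0n sum_nat_eq0 => /forallPn[i /=]; rewrite muln_eq0 negb_or -lt0n => /andP[bi].
  by rewrite eqb0 negbK => eq_v; exists i; rewrite bi.
by rewrite /row_content (bigD1 i) //= eq_v muln1 addn_gt0 bi.
Qed.

Lemma standard_min b : standard b -> b != 0%MM ->
  exists2 i, (0 < b i)%N & forall j r, (0 < b j)%N -> (plucker_col i r <= plucker_col j r)%N.
Proof.
move=> std_b b_neq0; have [i0 bi0] : exists i, (0 < b i)%N.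
  apply/existsP; apply: contraNT b_neq0 => /existsPn b0; apply/eqP/mnmP => i.
  by apply/eqP; rewrite mnm0E -leqn0 leqNgt b0.
have [i bi min_i] := @arg_minnP _ i0 (fun i => 0 < b i)%N (@col_sum k n) bi0.
exists i => // j r bj; move/forallP/(_ i)/forallP/(_ j): std_b.
rewrite bi bj => /orP[/forallP//|/forallP le_ji].
suff eq_ij : plucker_col i =1 plucker_col j by rewrite eq_ij.
move=> t; apply/val_inj/eqP; rewrite eq_sym eqn_leq le_ji /= leqNgt; apply/negP => lt_t.
have := min_i j bj; rewrite leqNgt => /negP; apply.
rewrite /col_sum (bigD1 t) // [X in (_ < X)%N](bigD1 t) //= -addSn leq_add //.
exact: leq_sum.
Qed.

Lemma standard_sub b i : standard b -> standard (b - U_(i))%MM.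
Proof.
move=> /forallP std_b; apply/forallP => j; apply/forallP => j'; apply/implyP.
rewrite !mnmBE => /andP[bj bj']; move/forallP/(_ j')/implyP: (std_b j); apply.
by rewrite (leq_trans bj (leq_subr _ _)) (leq_trans bj' (leq_subr _ _)).
Qed.

Lemma row_content_eq0 b (r : 'I_k) :
  (forall v, row_content b r v = 0%N) -> b = 0%MM.
Proof.
move=> b0; apply/mnmP => i; rewrite mnm0E; apply/eqP; rewrite -leqn0 leqNgt.
apply/negP => bi; have : (0 < row_content b r (plucker_col i r))%N.
  by rewrite row_content_gt0; apply/existsP; exists i; rewrite bi eqxx.
by rewrite b0.
Qed.

(** The least set of the chain consists of the least entry of each row, so the contents determine
    it; it is removed and induction applies. *)
Lemma standard_row_content_inj b c : (0 < k)%N -> standard b -> standard c ->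
  (forall r v, row_content b r v = row_content c r v) -> b = c.
Proof.
move=> k_gt0; pose r0 := Ordinal k_gt0.
have [d] := ubnP (mdeg b); elim: d b c => // d IHd b c lt_d std_b std_c eq_bc.
have [b0|b_neq0] := eqVneq b 0%MM.
  rewrite b0; apply/esym/(@row_content_eq0 c r0) => v; rewrite -eq_bc b0.
  by rewrite /row_content big1 // => i _; rewrite mnm0E.
have c_neq0 : c != 0%MM.
  apply: contraNneq b_neq0 => c0; apply/eqP/(@row_content_eq0 b r0) => v.
  by rewrite eq_bc c0 /row_content big1 // => i _; rewrite mnm0E.
have min_le (b1 b2 : 'X_{1..nP}) i j r : (0 < b2 j)%N ->
    (forall i' r', (0 < b1 i')%N -> plucker_col i r' <= plucker_col i' r')%N ->
    (forall r' v, row_content b1 r' v = row_content b2 r' v) ->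
    (plucker_col i r <= plucker_col j r)%N.
  move=> bj min_i eq12; have : (0 < row_content b2 r (plucker_col j r))%N.
    by rewrite row_content_gt0; apply/existsP; exists j; rewrite bj eqxx.
  rewrite -eq12 row_content_gt0 => /existsP[i' /andP[bi' /eqP <-]]; exact: min_i.
have [i bi min_i] := standard_min std_b b_neq0.
have [j cj min_j] := standard_min std_c c_neq0.
have ij : i = j.
  apply: plucker_col_ext => r; apply/val_inj/eqP; rewrite /= eqn_leq.
  by rewrite (min_le b c) // (min_le c b).
rewrite -{}ij in cj; have le_b : (U_(i) <= b)%MM by rewrite lep1mP -lt0n.
have le_c : (U_(i) <= c)%MM by rewrite lep1mP -lt0n.
rewrite -(submK le_b) -(submK le_c); congr (_ + _)%MM.
apply: IHd; try exact: standard_sub.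
  by rewrite -ltnS (leq_trans _ lt_d) // -{2}(submK le_b) mdegD mdeg1 addn1.
move=> r v; have := eq_bc r v; rewrite -{1}(submK le_b) -{1}(submK le_c).
by rewrite !row_contentD => /addIn.
Qed.

End RowContents.

Lemma sum_row_content k n (b : 'X_{1..nplucker k n}) (r : 'I_k) (psi : nat -> nat) (a T : nat) :
  (\sum_(a <= t < T) row_content b r (psi t) =
   \sum_i b i * \sum_(a <= t < T) (plucker_col i r == psi t :> nat))%N.
Proof.
by rewrite exchange_big; apply: eq_bigr => i _; rewrite big_distrr.
Qed.

(** * Row contents after the swap *)

Section MatchingContents.
Variables (k n l : nat).
Hypothesis l_le_n : (l <= n)%N.
Local Notation nP := (nplucker k.+2 n).
Implicit Types (b c : 'X_{1..nP}) (i j : 'I_nP).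
Local Notation r0 := (ord0 : 'I_k.+2).
Local Notation r1 := (inord 1 : 'I_k.+2).

Lemma col01 i : (plucker_col i r0 < plucker_col i r1)%N.
Proof. by apply: plucker_col_lt; rewrite inordK. Qed.

(* Entries of the first two rows are matched separately among the columns c < l,
   read from right to left, and among the columns c >= l, read from left to right. *)
Definition low_served b (t : nat) : nat :=
  served (fun t => row_content b r0 (l.-1 - t)) (fun t => row_content b r1 (l.-1 - t)) t.

Definition high_served b (t : nat) : nat :=
  served (fun t => row_content b r1 (l + t)) (fun t => row_content b r0 (l + t)) t.

Lemma sum_low_eq (x a : nat) :
  (\sum_(a <= i < l) (x == l.-1 - i) = ((x < l) && (a <= l.-1 - x)))%N.
Proof.
have [lt_l|ge_l] := ltnP x l; last first.
  by rewrite big_nat big1 // => i /andP[_ lt_il]; case: eqP => // eq_i; lia.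
transitivity (nat_of_bool (a <= l.-1 - x < l)%N); last by congr nat_of_bool; lia.
rewrite -sum_pred1_nat !big_nat; apply: eq_bigr => i /andP[_ lt_il].
by congr nat_of_bool; apply/eqP/eqP; lia.
Qed.

Lemma sum_high_eq (x a : nat) : (x < n)%N ->
  (\sum_(a <= i < n - l) (x == l + i) = (l + a <= x))%N.
Proof.
move=> lt_n; have [le_l|gt_l] := leqP l x; last first.
  rewrite big_nat big1 // => [|i _]; first by case: leqP => //; lia.
  by case: eqP => //; lia.
rewrite (_ : (l + a <= _)%N = (a <= x - l < n - l)%N); last lia.
rewrite -sum_pred1_nat !big_nat; apply: eq_bigr => i _.
by congr nat_of_bool; apply/eqP/eqP; lia.
Qed.

(** Column by column: a second entry below l has its first entry further left, which is read
    strictly later. *)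
Lemma low_dom b t : (t < l)%N ->
  (\sum_(t <= i < l) row_content b r1 (l.-1 - i) <=
   \sum_(t.+1 <= i < l) row_content b r0 (l.-1 - i))%N.
Proof.
move=> lt_tl; rewrite !sum_row_content; apply: leq_sum => j _; rewrite leq_mul2l; apply/orP; right.
rewrite !sum_low_eq; have := col01 j; lia.
Qed.

Lemma high_dom b t : (t < n - l)%N ->
  (\sum_(t <= i < n - l) row_content b r0 (l + i) <=
   \sum_(t.+1 <= i < n - l) row_content b r1 (l + i))%N.
Proof.
move=> lt_t; rewrite !sum_row_content; apply: leq_sum => j _; rewrite leq_mul2l; apply/orP; right.
rewrite !sum_high_eq //; have := col01 j; lia.
Qed.

Lemma sum_row_content_all b (r : 'I_k.+2) :
  (\sum_(0 <= i < l) row_content b r (l.-1 - i) +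
   \sum_(0 <= i < n - l) row_content b r (l + i) = mdeg b)%N.
Proof.
rewrite !sum_row_content -big_split mdegE; apply: eq_bigr => j _ /=.
rewrite sum_low_eq sum_high_eq //; case: (ltnP (plucker_col j r) l) => ?; lia.
Qed.

Definition served_at b (v : nat) : nat :=
  if (v < l)%N then low_served b (l.-1 - v) else high_served b (v - l).

(* Matched entries stay in their row; the unmatched ones, which lie in the first
   row if v < l and in the second one otherwise, are swapped by the matching field
   and change rows. *)
Definition matching_entry b (r : 'I_k.+2) (v : nat) : nat :=
  let moved := (row_content b r0 v + row_content b r1 v - served_at b v)%N in
  if r == r0 then if (v < l)%N then served_at b v else moved
  else if r == r1 then if (v < l)%N then moved else served_at b v
  else row_content b r v.

Definition matching_content b : 'X_{1..k.+2 * n} :=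
  [multinom mxvec (\matrix_(r < k.+2, v < n) matching_entry b r v) ord0 j | j < k.+2 * n].

Lemma matching_contentE b r v :
  matching_content b (mxvec_index r v) = matching_entry b r v.
Proof. by rewrite mnmE mxvecE mxE. Qed.

Lemma r1_neq_r0 : (r1 == r0) = false.
Proof. by rewrite -val_eqE /= inordK. Qed.

Lemma low_served_le b t :
  (low_served b t <= row_content b r0 (l.-1 - t))%N.
Proof. exact: served_le. Qed.

Lemma high_served_le b t :
  (high_served b t <= row_content b r1 (l + t))%N.
Proof. exact: served_le. Qed.

Lemma served_at_le b v : (served_at b v <= row_content b r0 v + row_content b r1 v)%N.
Proof.
rewrite /served_at; case: ltnP => [lt_v|ge_v].
  have := low_served_le b (l.-1 - v); rewrite (_ : l.-1 - (l.-1 - v) = v)%N; lia.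
by have := high_served_le b (v - l); rewrite subnKC //; lia.
Qed.

(** The first two rows at v give back [served_at] and the total content; in both blocks the queue
    ends empty, so time can be run backwards from a known state. *)
Lemma matching_content_inj b c : standard b -> standard c ->
  matching_content b = matching_content c -> b = c.
Proof.
move=> std_b std_c eq_bc.
have eq_entry r v : (v < n)%N -> matching_entry b r v = matching_entry c r v.
  by move=> lt_v; rewrite -(matching_contentE b r (Ordinal lt_v)) eq_bc matching_contentE.
have [eq_served eq_sum] : (forall v, (v < n)%N -> served_at b v = served_at c v) /\
    (forall v, (v < n)%N -> row_content b r0 v + row_content b r1 v =
                            row_content c r0 v + row_content c r1 v)%N.
  split=> v lt_v; have := eq_entry r0 v lt_v; have := eq_entry r1 v lt_v;
  rewrite /matching_entry eqxx r1_neq_r0 eqxx; have := served_at_le b v;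
  have := served_at_le c v; case: ifP => _; lia.
have eq_low v : (v < l)%N -> row_content b r0 v = row_content c r0 v /\
    row_content b r1 v = row_content c r1 v.
  move=> lt_v; have lt_t : (l.-1 - v < l)%N by lia.
  have -> : v = (l.-1 - (l.-1 - v))%N by lia.
  move: (l.-1 - v)%N lt_t.
  apply: (@queue_inj (fun t => row_content b r0 (l.-1 - t)) (fun t => row_content b r1 (l.-1 - t))
    (fun t => row_content c r0 (l.-1 - t)) (fun t => row_content c r1 (l.-1 - t)) l).
  - by rewrite !queue_empties //; apply: low_dom.
  - move=> t lt_t; have := eq_served (l.-1 - t)%N; rewrite /served_at.
    rewrite (_ : l.-1 - t < l)%N; last lia.
    by rewrite (_ : l.-1 - (l.-1 - t) = t)%N; [apply; lia|lia].
  by move=> t lt_t; apply: eq_sum; lia.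
have eq_high v : (l <= v)%N -> (v < n)%N -> row_content b r0 v = row_content c r0 v /\
    row_content b r1 v = row_content c r1 v.
  move=> le_v lt_v; have lt_t : (v - l < n - l)%N by lia.
  rewrite -(subnKC le_v); move: (v - l)%N lt_t => u lt_u.
  suff [] : row_content b r1 (l + u) = row_content c r1 (l + u) /\
    row_content b r0 (l + u) = row_content c r0 (l + u) by [].
  move: u lt_u.
  apply: (@queue_inj (fun t => row_content b r1 (l + t)) (fun t => row_content b r0 (l + t))
    (fun t => row_content c r1 (l + t)) (fun t => row_content c r0 (l + t)) (n - l)).
  - by rewrite !queue_empties //; apply: high_dom.
  - move=> t lt_t; have := eq_served (l + t)%N; rewrite /served_at [(l + t < l)%N]ltnNge leq_addr /= addKn.
    by apply; lia.
  by move=> t lt_t; rewrite addnC [RHS]addnC; apply: eq_sum; lia.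
apply: standard_row_content_inj => // r v.
have [ge_n|lt_n] := leqP n v; first by rewrite !row_content_out.
have [eq0 eq1] : row_content b r0 v = row_content c r0 v /\
    row_content b r1 v = row_content c r1 v.
  by have [/eq_low|le_v] := ltnP v l; last exact: eq_high.
have [->//|r_r0] := eqVneq r r0; have [->//|r_r1] := eqVneq r r1.
by have := eq_entry r v lt_n; rewrite /matching_entry (negPf r_r0) (negPf r_r1).
Qed.

End MatchingContents.

(** * Pairing the entries of the first two rows *)

Section MatchingPairs.
Variables (k n l : nat).
Hypothesis l_le_n : (l <= n)%N.
Local Notation nP := (nplucker k.+2 n).
Variable b : 'X_{1..nP}.
Local Notation r0 := (ord0 : 'I_k.+2).
Local Notation r1 := (inord 1 : 'I_k.+2).
Local Notation low F := (multilist F (fun t => l.-1 - t)%N l).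
Local Notation high F := (multilist F (fun t => l + t)%N (n - l)).

Lemma count_low F v : count_mem v (low F) = if (v < l)%N then F (l.-1 - v)%N else 0%N.
Proof.
rewrite count_multilist; case: ltnP => [lt_v|ge_v]; last first.
  rewrite big_nat big1 // => t /andP[_ lt_t] /=; case: eqP => // ?; lia.
have lt_t : (l.-1 - v < l)%N by lia.
rewrite big_mkord (bigD1 (Ordinal lt_t)) //= big1 => [|t neq_t].
  by rewrite addn0 (_ : (_ == v) = true) ?mul1n //; lia.
case: eqP => // eq_v; case/negP: neq_t; apply/eqP/val_inj => /=.
by have := ltn_ord t; lia.
Qed.

Lemma count_high F v : (v < n)%N ->
  count_mem v (high F) = if (v < l)%N then 0%N else F (v - l)%N.
Proof.
move=> lt_n; rewrite count_multilist; case: ltnP => [lt_v|ge_v].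
  by rewrite big1 // => t _ /=; case: eqP => // ?; lia.
have lt_t : (v - l < n - l)%N by lia.
rewrite big_mkord (bigD1 (Ordinal lt_t)) //= big1 => [|t neq_t].
  by rewrite addn0 (_ : (_ == v) = true) ?mul1n //; lia.
case: eqP => // eq_v; case/negP: neq_t; apply/eqP/val_inj => /=; lia.
Qed.

Lemma all_low F : all (fun v => v < l)%N (low F).
Proof.
apply/allP => v; rewrite -has_pred1 has_count count_low; case: ifP => //.
Qed.

Lemma all_high F : all (fun v => l <= v < n)%N (high F).
Proof.
apply/allP => v /flatten_mapP[t]; rewrite mem_index_iota => /andP[_ lt_t].
by rewrite mem_nseq => /andP[_ /eqP->]; lia.
Qed.

(** Time runs from right to left, so early times are large entries; equality of the totals turns the
    bound on them into the one on small entries used by [increasing_pairing]. *)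
Lemma low_pairing (F G : nat -> nat) :
    (\sum_(0 <= t < l) F t = \sum_(0 <= t < l) G t)%N ->
    (forall t, t < l -> \sum_(0 <= i < t.+1) F i <= \sum_(0 <= i < t) G i)%N ->
  exists zs : seq (nat * nat), [/\ perm_eq (unzip1 zs) (low F), perm_eq (unzip2 zs) (low G) &
    all (fun z => z.1 < z.2)%N zs].
Proof.
move=> eq_sum dom; apply: increasing_pairing; first by rewrite !size_multilist.
move=> v; have [ge_v|lt_v] := leqP l v.
  rewrite (@eq_in_count _ _ predT) => [|y /(allP (all_low G)) lt_y]; last by rewrite /= ltnW ?(leq_trans lt_y).
  rewrite [X in (_ <= X)%N](@eq_in_count _ _ predT) => [|y /(allP (all_low F)) lt_y]; last first.
    by rewrite /= (leq_trans lt_y).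
  by rewrite !count_predT !size_multilist eq_sum.
rewrite !count_multilist.
have lt_t : (l.-1 - v < l)%N by lia.
have sumE (H : nat -> nat) (P : pred nat) a : (a <= l)%N ->
    (forall t, (t < l)%N -> P (l.-1 - t)%N = (a <= t)%N) ->
    (\sum_(0 <= t < l) P (l.-1 - t) * H t = \sum_(a <= t < l) H t)%N.
  move=> le_a PE; rewrite (@big_cat_nat _ _ _ a) //= big_nat big1 => [|t /andP[_ lt_ta]].
    rewrite add0n !big_nat; apply: eq_bigr => t /andP[le_at lt_tl].
    by rewrite PE // le_at mul1n.
  by rewrite PE ?(leq_trans lt_ta) // leqNgt lt_ta.
rewrite (sumE G (fun y => y <= v)%N (l.-1 - v)%N) ?(ltnW lt_t) => [|//|t lt_tl]; last lia.
rewrite (sumE F (fun y => y < v)%N (l.-1 - v).+1%N) // => [|t lt_tl]; last lia.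
have := dom _ lt_t; move: eq_sum.
rewrite [X in X = _](@big_cat_nat _ _ _ (l.-1 - v).+1%N) //=.
rewrite [X in _ = X](@big_cat_nat _ _ _ (l.-1 - v)%N) ?(ltnW lt_t) //=; lia.
Qed.

Lemma high_pairing (F G : nat -> nat) :
    (\sum_(0 <= t < n - l) F t = \sum_(0 <= t < n - l) G t)%N ->
    (forall t, t < n - l -> \sum_(0 <= i < t.+1) G i <= \sum_(0 <= i < t) F i)%N ->
  exists zs : seq (nat * nat), [/\ perm_eq (unzip1 zs) (high F), perm_eq (unzip2 zs) (high G) &
    all (fun z => z.1 < z.2)%N zs].
Proof.
move=> eq_sum dom; apply: increasing_pairing; first by rewrite !size_multilist.
move=> v; have [ge_v|lt_v] := leqP n v.
  rewrite (@eq_in_count _ _ predT) => [|y /(allP (all_high G))]; last by move=> /=; lia.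
  rewrite [X in (_ <= X)%N](@eq_in_count _ _ predT) => [|y /(allP (all_high F))]; last first.
    by move=> /=; lia.
  by rewrite !count_predT !size_multilist eq_sum.
have [ge_v|lt_vl] := leqP l v; last first.
  by rewrite (@eq_in_count _ _ pred0) ?count_pred0 // => y /(allP (all_high G)) /=; lia.
rewrite !count_multilist; have lt_t : (v - l < n - l)%N by lia.
have sumE (H : nat -> nat) (P : pred nat) a : (a <= n - l)%N ->
    (forall t, (t < n - l)%N -> P (l + t)%N = (t < a)%N) ->
    (\sum_(0 <= t < n - l) P (l + t) * H t = \sum_(0 <= t < a) H t)%N.
  move=> le_a PE; rewrite (@big_cat_nat _ _ _ a) //= [X in (_ + X)%N]big_nat.
  rewrite [X in (_ + X)%N]big1 => [|t /andP[le_at lt_t']].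
    rewrite addn0 !big_nat; apply: eq_bigr => t /andP[_ lt_ta].
    by rewrite PE ?lt_ta ?mul1n // (leq_trans lt_ta).
  by rewrite PE // ltnNge le_at.
rewrite (sumE G (fun y => y <= v)%N (v - l).+1%N) // => [|t lt_t']; last lia.
rewrite (sumE F (fun y => y < v)%N (v - l)%N) ?(ltnW lt_t) // => [|t lt_t']; last lia.
exact: dom.
Qed.

Lemma matching_pairs : exists zs : seq (nat * nat),
  [/\ all (fun z => z.1 < z.2 < n)%N zs,
      forall v, (v < n)%N -> count_mem v (unzip2 zs) = row_content b r1 v &
      forall v, (v < n)%N ->
        count (fun z => (if z.1 < l <= z.2 then z.2 else z.1) == v)%N zs =
          matching_entry l b r0 v /\
        count (fun z => (if z.1 < l <= z.2 then z.1 else z.2) == v)%N zs =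
          matching_entry l b r1 v].
Proof.
pose pl t := row_content b r0 (l.-1 - t); pose ql t := row_content b r1 (l.-1 - t).
pose ph t := row_content b r0 (l + t); pose qh t := row_content b r1 (l + t).
have sum_low : (\sum_(0 <= t < l) low_served l b t = \sum_(0 <= t < l) ql t)%N.
  by apply: sum_served; apply: low_dom.
have sum_high : (\sum_(0 <= t < n - l) high_served l b t = \sum_(0 <= t < n - l) ph t)%N.
  by apply: sum_served; apply: high_dom.
have [zC [zC1 zC2 ltC]] := low_pairing sum_low (fun t _ => sum_served_lt pl ql t).
have [zA [zA1 zA2 ltA]] :=
  high_pairing (esym sum_high) (fun t _ => sum_served_lt qh ph t).
pose XB := low (fun t => pl t - low_served l b t)%N.
pose YB := high (fun t => qh t - high_served l b t)%N.
(* Both rows have [mdeg b] entries and all tokens are used, so equally many entries stay unmatched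
   in the two blocks. *)
have size_B : size XB = size YB.
  have sum_p : (\sum_(0 <= t < l) pl t + \sum_(0 <= t < n - l) ph t = mdeg b)%N.
    exact: sum_row_content_all.
  have sum_q : (\sum_(0 <= t < l) ql t + \sum_(0 <= t < n - l) qh t = mdeg b)%N.
    exact: sum_row_content_all.
  have sum_pl : (\sum_(0 <= t < l) (pl t - low_served l b t) +
                 \sum_(0 <= t < l) low_served l b t = \sum_(0 <= t < l) pl t)%N.
    by rewrite -big_split; apply: eq_bigr => t _; apply/subnK/low_served_le.
  have sum_qh : (\sum_(0 <= t < n - l) (qh t - high_served l b t) +
                 \sum_(0 <= t < n - l) high_served l b t = \sum_(0 <= t < n - l) qh t)%N.
    by rewrite -big_split; apply: eq_bigr => t _; apply/subnK/high_served_le.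
  by rewrite !size_multilist; lia.
have [zB [zB1 zB2 ltB]] : exists zs : seq (nat * nat), [/\ perm_eq (unzip1 zs) XB,
    perm_eq (unzip2 zs) YB & all (fun z => z.1 < z.2)%N zs].
  apply: (increasing_pairing size_B) => v; have [ge_v|lt_v] := leqP l v.
    rewrite [X in (_ <= X)%N](@eq_in_count _ _ predT) => [|y /(allP (all_low _)) lt_y]; last first.
      by rewrite /= (leq_trans lt_y).
    by rewrite count_predT size_B count_size.
  by rewrite (@eq_in_count _ _ pred0) ?count_pred0 // => y /(allP (all_high _)) /=; lia.
have lowC z : z \in zC -> (z.1 < l)%N && (z.2 < l)%N.
  move=> zz; rewrite (allP (all_low (low_served l b))) ?(allP (all_low ql)) //.
    by rewrite -(perm_mem zC2) map_f.
  by rewrite -(perm_mem zC1) map_f.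
have highA z : z \in zA -> (l <= z.1 < n)%N && (l <= z.2 < n)%N.
  move=> zz; rewrite (allP (all_high ph)) ?(allP (all_high (high_served l b))) //.
    by rewrite -(perm_mem zA2) map_f.
  by rewrite -(perm_mem zA1) map_f.
have crossB z : z \in zB -> (z.1 < l)%N && (l <= z.2 < n)%N.
  move=> zz; rewrite (allP (all_low (fun t => pl t - low_served l b t)%N)).
    by rewrite (allP (all_high (fun t => qh t - high_served l b t)%N)) // -(perm_mem zB2) map_f.
  by rewrite -(perm_mem zB1) map_f.
have countE (zs : seq (nat * nat)) (f : nat * nat -> nat) (s : seq nat) v :
    perm_eq (map f zs) s -> count (fun z => f z == v) zs = count_mem v s.
  by move=> /seq.permP <-; rewrite count_map.
exists (zC ++ zB ++ zA); split.
- rewrite !all_cat; apply/and3P; split; apply/allP => z zz.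
  + by have /= := allP ltC z zz; have := lowC z zz => /=; lia.
  + by have /= := allP ltB z zz; have := crossB z zz => /=; lia.
  by have /= := allP ltA z zz; have := highA z zz => /=; lia.
- move=> v lt_v; rewrite /unzip2 !map_cat !count_cat (seq.permP zC2) (seq.permP zB2) (seq.permP zA2).
  rewrite count_low !count_high //; case: ltnP => [lt_vl|ge_vl].
    by rewrite !addn0 /ql (_ : l.-1 - (l.-1 - v) = v)%N //; lia.
  rewrite add0n /qh subnKC // subnK //.
  by have := high_served_le l b (v - l); rewrite subnKC.
move=> v lt_v; rewrite !count_cat; split.
  rewrite (@eq_in_count _ _ (fun z => z.1 == v)) => [|z /lowC/andP[_ lt2]]; last first.
    by rewrite [(l <= _)%N]leqNgt lt2 andbF.
  rewrite (countE _ _ _ _ zC1).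
  rewrite (@eq_in_count _ _ (fun z => z.2 == v)) => [|z /crossB/andP[-> /andP[-> _]]] //.
  rewrite (countE _ _ _ _ zB2).
  rewrite (@eq_in_count _ _ (fun z => z.1 == v)) => [|z /highA/andP[/andP[ge1 _] _]]; last first.
    by rewrite ltnNge ge1.
  rewrite (countE _ _ _ _ zA1) count_low !count_high // /matching_entry eqxx /served_at.
  case: ltnP => [lt_vl|ge_vl]; first by rewrite !addn0.
  rewrite add0n /qh /ph subnKC //.
  by have := high_served_le l b (v - l); rewrite subnKC //; lia.
rewrite (@eq_in_count _ _ (fun z => z.2 == v)) => [|z /lowC/andP[_ lt2]]; last first.
  by rewrite [(l <= _)%N]leqNgt lt2 andbF.
rewrite (countE _ _ _ _ zC2).
rewrite (@eq_in_count _ _ (fun z => z.1 == v)) => [|z /crossB/andP[-> /andP[-> _]]] //.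
rewrite (countE _ _ _ _ zB1).
rewrite (@eq_in_count _ _ (fun z => z.2 == v)) => [|z /highA/andP[/andP[ge1 _] _]]; last first.
  by rewrite ltnNge ge1.
rewrite (countE _ _ _ _ zA2) !count_low !count_high // /matching_entry r1_neq_r0 eqxx /served_at.
case: ltnP => [lt_vl|ge_vl]; last by rewrite !add0n.
have eq_v : (l.-1 - (l.-1 - v) = v)%N by lia.
have := low_served_le l b (l.-1 - v); rewrite eq_v /ql /pl eq_v; lia.
Qed.

End MatchingPairs.

Lemma count_expand N (b : 'X_{1..N}) (P : pred 'I_N) :
  count P (flatten [seq nseq (b i) i | i <- enum 'I_N]) = (\sum_i b i * P i)%N.
Proof.
rewrite count_flatten -map_comp sumnE big_map big_enum /=.
by apply: eq_bigr => i _; rewrite /= count_nseq mulnC.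
Qed.

Lemma map_eq_zip (S S' W : eqType) (f : S -> W) (g : S' -> W) s t :
  map f s = map g t -> {in zip s t, forall w, f w.1 = g w.2}.
Proof.
elim: s t => [|x s IHs] [|y t] //= [eq_xy eq_st] w.
by rewrite inE => /orP[/eqP->//|]; apply: IHs.
Qed.

Lemma minor_mon_entry k n (i : 'I_(nplucker k n)) (sigma : 'S_k) r v :
  minor_mon i sigma (mxvec_index r v) = (plucker_col i ((sigma^-1)%g r) == v).
Proof.
rewrite mnm_sumE (bigD1 ((sigma^-1)%g r)) //= mnm1E permKV big1 ?addn0 => [|s s_r].
  by congr nat_of_bool; apply/eqP/eqP => [/mxvec_index_inj[]|->].
rewrite mnm1E; case: eqP => // /mxvec_index_inj[sr _].
by rewrite -sr permK eqxx in s_r.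
Qed.

(** * Matching field tableaux with the given row contents *)

Section Realization.
Variables (k n l : nat).
Hypothesis l_le_n : (l <= n)%N.
Local Notation nP := (nplucker k.+2 n).
Implicit Types (b c : 'X_{1..nP}) (i : 'I_nP).
Local Notation r0 := (ord0 : 'I_k.+2).
Local Notation r1 := (inord 1 : 'I_k.+2).
Local Notation crossing i := (plucker_col i r0 < l <= plucker_col i r1)%N.

Lemma lead_mon_minor_entry i (r : 'I_k.+2) v :
  lead_mon_minor l i (mxvec_index r v) =
  ((if r == r0 then if crossing i then plucker_col i r1 else plucker_col i r0
    else if r == r1 then if crossing i then plucker_col i r0 else plucker_col i r1
    else plucker_col i r) == v).
Proof.
rewrite /lead_mon_minor minor_mon_entry; congr ((_ == _) : nat).
rewrite /block_matching card_plucker_set /= crossing_card.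
case: (crossing i) => /=; last first.
  by rewrite invg1 perm1; case: (r =P r0) => [->|_] //; case: (r =P r1) => [->|].
rewrite tpermV; case: (r =P r0) => [->|/eqP r_r0]; first by rewrite tpermL.
case: (r =P r1) => [->|/eqP r_r1]; first by rewrite tpermR.
by rewrite tpermD // eq_sym.
Qed.

(** Only the second entry bounds the first one, so a pair (x, y) can top the lower part of any
    column with second entry y. *)
Lemma replace_first_col (x : nat) i : (x < plucker_col i r1)%N ->
  exists2 j, plucker_col j r0 = x :> nat &
    forall r, r != r0 -> plucker_col j r = plucker_col i r.
Proof.
move=> lt_x; have lt_xn : (x < n)%N by apply: leq_trans lt_x _; apply: ltnW.
pose g (r : 'I_k.+2) := if r == r0 then Ordinal lt_xn else plucker_col i r.
have g_mono (t t' : 'I_k.+2) : (t < t')%N -> (g t < g t')%N.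
  move=> lt_tt'; rewrite /g; have -> : (t' == r0) = false.
    by apply/negbTE; apply: contraTneq lt_tt' => ->.
  case: eqP => [t0|_]; last exact: plucker_col_lt.
  apply: (leq_trans lt_x) => /=; rewrite leqNgt; apply/negP => /= lt_col.
  have : (t' < r1)%N.
    rewrite ltnNge leq_eqVlt; apply/negP => /orP[/eqP/val_inj eq_t'|].
      by rewrite eq_t' ltnn in lt_col.
    by move=> /(plucker_col_lt i)/ltnW; rewrite leqNgt lt_col.
  by rewrite inordK // ltnS leqn0; move: lt_tt'; case: (nat_of_ord t').
have [j jE] := increasing_plucker_col g_mono; exists j => [|r r_r0].
  by rewrite jE /g eqxx.
by rewrite jE /g (negPf r_r0).
Qed.

Lemma matching_content_cls b :
  exists2 c, mdeg c = mdeg b & cls (@lead_mon_minor k.+2 n l) c = matching_content l b.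
Proof.
have [zs [zs_lt zs_y zs_entry]] := matching_pairs l_le_n b.
pose cs := flatten [seq nseq (b i) i | i <- enum 'I_nP].
have size_cs : size cs = mdeg b.
  rewrite -count_predT count_expand mdegE; apply: eq_bigr => i _; exact: muln1.
have count_cs (r : 'I_k.+2) v :
    count (fun i => plucker_col i r == v :> nat) cs = row_content b r v.
  exact: count_expand.
(* Pairs and original columns have the same multiset of second entries, so each pair can be assigned
   a column sharing its second entry. *)
have perm_y : perm_eq (unzip2 zs) [seq val (plucker_col i r1) | i <- cs].
  apply/allP => v _ /=; rewrite count_map; apply/eqP.
  have [ge_n|lt_n] := leqP n v; last by rewrite zs_y // -count_cs.
  rewrite !(@eq_in_count _ _ pred0) ?count_pred0 // => [i _|y /mapP[z /(allP zs_lt)/andP[_ lt_zn] ->]].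
    by rewrite /= ltn_eqF // (leq_trans (ltn_ord _)).
  by rewrite /= ltn_eqF // (leq_trans lt_zn).
have [zs' perm_zs' eq_y] := perm_map_align perm_y.
pose ws := zip zs' cs.
have size_zs' : size zs' = size cs by rewrite -(size_map snd) eq_y size_map.
have ws1 : unzip1 ws = zs' by rewrite unzip1_zip ?size_zs'.
have ws2 : unzip2 ws = cs by rewrite unzip2_zip ?size_zs'.
have ws_y w : w \in ws -> w.1.2 = plucker_col w.2 r1 by apply: (map_eq_zip eq_y).
have ws_lt w : w \in ws -> (w.1.1 < plucker_col w.2 r1)%N.
  move=> ww; rewrite -(ws_y w ww).
  have : w.1 \in zs by rewrite -(perm_mem perm_zs') -ws1 map_f.
  by move=> /(allP zs_lt)/andP[].
have /fin_all_exists[f fP] : forall j : 'I_(size ws), exists i, forall w,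
    w = tnth (in_tuple ws) j -> plucker_col i r0 = w.1.1 :> nat /\
    forall r, r != r0 -> plucker_col i r = plucker_col w.2 r.
  move=> j; have [i i0 ir] := replace_first_col (ws_lt _ (mem_tnth j (in_tuple ws))).
  by exists i => w ->.
exists (\sum_j U_(f j))%MM.
  rewrite mdeg_sum (eq_bigr (fun=> 1%N)) => [|j _]; last exact: mdeg1.
  by rewrite sum1_card card_ord size_zip size_zs' minnn size_cs.
have cls0 : cls (@lead_mon_minor k.+2 n l) 0%MM = 0%MM.
  by rewrite /cls big1 // => i _; rewrite mnm0E mulm0n.
rewrite (big_morph _ (@clsD _ _ _) cls0); apply/mnmP => q; case/mxvec_indexP: q => r v.
rewrite matching_contentE mnm_sumE.
pose entry (w : nat * nat * 'I_nP) := (if r == r0 then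
      if (w.1.1 < l <= w.1.2)%N then w.1.2 else w.1.1
    else if r == r1 then if (w.1.1 < l <= w.1.2)%N then w.1.1 else w.1.2
    else plucker_col w.2 r)%N.
have entryE j : cls (@lead_mon_minor k.+2 n l) U_(f j)%MM (mxvec_index r v) =
    (entry (tnth (in_tuple ws) j) == v).
  have [f0 fr] := fP j _ erefl; have y_eq := ws_y _ (mem_tnth j (in_tuple ws)).
  have f1 : plucker_col (f j) r1 = (tnth (in_tuple ws) j).1.2 :> nat.
    by rewrite fr ?y_eq // r1_neq_r0.
  rewrite cls1 lead_mon_minor_entry -val_eqE /entry !(fun_if val) /= f0 f1.
  by case: (r =P r0) => // /eqP/fr ->.
under eq_bigr => j _ do rewrite entryE.
transitivity (count (fun w => entry w == v) ws).
  rewrite -sum1_count [RHS]big_mkcond [RHS]big_tnth; apply: eq_bigr => j _.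
  by case: eqP.
have zs'E (P : pred (nat * nat)) : count (fun w : nat * nat * 'I_nP => P w.1) ws = count P zs.
  by rewrite -(seq.permP perm_zs') -ws1 count_map.
have [entry0 entry1] := zs_entry v (ltn_ord v).
have [r_r0|r_r0] := eqVneq r r0.
  rewrite r_r0 -entry0 -zs'E; apply: eq_count => w.
  by rewrite /entry r_r0 eqxx.
have [r_r1|r_r1] := eqVneq r r1.
  rewrite r_r1 -entry1 -zs'E; apply: eq_count => w.
  by rewrite /entry r_r1 r1_neq_r0 eqxx.
rewrite /matching_entry (negPf r_r0) (negPf r_r1) -count_cs -ws2 count_map.
by apply: eq_count => w; rewrite /entry (negPf r_r0) (negPf r_r1).
Qed.

End Realization.

Lemma nplucker_gt0 k n : (k <= n)%N -> (0 < nplucker k n)%N.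
Proof. by move=> le_kn; rewrite /nplucker card_draws card_ord bin_gt0. Qed.

Lemma exists_matching_content k n l : (0 < k)%N -> (l <= n)%N ->
  exists2 phi : 'X_{1..nplucker k n} -> 'X_{1..k * n},
    forall b, exists2 c, mdeg c = mdeg b & cls (@lead_mon_minor k n l) c = phi b &
    {in @standard k n &, injective phi}.
Proof.
case: k => [|[|k]] // _ l_le_n; last first.
  exists (matching_content l) => [b|b c std_b std_c]; first exact: matching_content_cls.
  exact: matching_content_inj.
(* For k = 1 nothing is swapped, and the class itself records the row content. *)
exists (cls (@lead_mon_minor 1 n l)) => [b|b c std_b std_c eq_bc]; first by exists b.
have clsE d r v : cls (@lead_mon_minor 1 n l) d (mxvec_index r v) = row_content d r v.
  rewrite mnm_sumE; apply: eq_bigr => i _; rewrite mulmnE minor_mon_entry mulnC.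
  by rewrite -val_eqE /= !ord1.
apply: standard_row_content_inj => // r v; have [ge_n|lt_n] := leqP n v.
  by rewrite !row_content_out.
by rewrite -!(clsE _ r (Ordinal lt_n)) eq_bc.
Qed.

Theorem corollary4p7 (K : fieldType) (charK : [pchar K] =i pred0)
    (k n l : nat) (k_ge1 : (1 <= k)%N) (k_le_n : (k <= n)%N)
    (l_le_n : (l <= n)%N) :
  let G := plucker_ideal K k n in
  let Y := groebner_family (plucker_weight K k n l) G in
  toric_degeneration G Y /\ same_subscheme (fibre0 Y) (matching_ideal K k n l).
Proof.
have [phi phi_cls phi_inj] := exists_matching_content k_ge1 l_le_n.
have [] := @sagbi_degeneration K (nplucker k n) (k * n) k (@term_weight k n l)
  (@plucker_minor K k n) (@lead_mon_minor k n l) (@lead_sign K k n l)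
  (plucker_weight K k n l) (@standard k n) phi (plucker_weightE K l_le_n)
  (@term_weightD k n l) (nplucker_gt0 k_le_n) k_ge1
  (fun i => mdeg_minor_mon i _) (@lead_sign_neq0 K k n l)
  (@is_lead_minor K k n l l_le_n) (straightening charK) (fun b _ => phi_cls b) phi_inj.
move=> degen same; split=> //.
suff matchingE f : matching_ideal K k n l f <->
    initial_ideal (@lead_mon_minor k n l) (@lead_sign K k n l) f.
  move=> R S; split=> [/same[projS SE]|[projS SE]].
    by split=> // f v /matchingE; apply: SE.
  by apply/same; split=> // f v /matchingE; apply: SE.
rewrite /matching_ideal /initial_ideal.
suff -> : [tuple matching_term K l i | i < nplucker k n] =
  [tuple lead_sign K l i *: 'X_[lead_mon_minor l i] | i < nplucker k n] by [].
by apply: eq_from_tnth => i; rewrite !tnth_mktuple matching_termE.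
Qed.
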